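(* Let $(M,g,\phi,\xi,\eta)$ be a $(2n+1)$-dimensional $\eta$-Einstein Kenmotsu manifold. If there exist a vector field $V$ and real constants $\lambda,\mu$ such that $(g,V,\lambda,\mu)$ is a conformal $\eta$-Ricci soliton on $M$, then $M$ is an Einstein manifold.
   Context: An almost contact metric manifold $(M,g,\phi,\xi,\eta)$ of dimension $2n+1$ ($n\ge 1$) is a smooth Riemannian manifold $(M,g)$ with a $(1,1)$-tensor field $\phi$, a vector field $\xi$ and a 1-form $\eta$ such that $\phi^2=-I+\eta\otimes\xi$, $\eta(\xi)=1$, $\eta(X)=g(X,\xi)$ and $g(\phi X,\phi Y)=g(X,Y)-\eta(X)\eta(Y)$ for all vector fields $X,Y$. It is a Kenmotsu manifold if its Levi-Civita connection $\nabla$ satisfies $(\nabla_X\phi)Y=g(\phi X,Y)\xi-\eta(Y)\phi X$ for all $X,Y$. A Kenmotsu manifold is $\eta$-Einstein if its Ricci tensor satisfies $S(X,Y)=\alpha g(X,Y)+\beta\eta(X)\eta(Y)$ for all $X,Y$, for some smooth functions $\alpha,\beta$ on $M$; it is Einstein if this holds with $\beta=0$. A conformal $\eta$-Ricci soliton $(g,V,\lambda,\mu)$ on a $(2n+1)$-dimensional almost contact metric manifold consists of a smooth vector field $V$ and real constants $\lambda,\mu$ such that $$\mathcal{L}_V g+2S+\left[2\lambda-\left(p+\tfrac{2}{2n+1}\right)\right]g+2\mu\,\eta\otimes\eta=0,$$ where $\mathcal{L}_V$ is the Lie derivative along $V$, $S$ is the Ricci tensor of $g$, and $p$ (the conformal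 pressure) is a scalar that is constant on $M$. *)

(* Defs.v *)
From HB Require Import structures.
From mathcomp Require Import all_boot all_order all_algebra.
From mathcomp Require Import all_classical all_reals all_analysis.

Set Implicit Arguments.
Unset Strict Implicit.
Unset Printing Implicit Defensive.
Import Order.TTheory GRing.Theory Num.Theory.
Import numFieldNormedType.Exports.
Local Open Scope classical_set_scope.
Local Open Scope ring_scope.

(* Smooth manifolds are Hausdorff second countable spaces with a smooth atlas.
   Vector fields are the derivations of the algebra of smooth functions, and
   tensor fields are the maps on vector fields that are linear over the ring of
   smooth functions. *)

(* Meant for open [U] and finite-dimensional [V]: there, [f] is C^(k+1) on [U]
   iff it is differentiable on [U] and all its directional derivatives are C^k
   on [U]. *)
Fixpoint Ck (R : realType) (V W : normedModType R) (k : nat) (U : set V)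
    (f : V -> W) : Prop :=
  match k with
  | 0%N => forall x, U x -> {for x, continuous f}
  | k'.+1 => (forall x, U x -> differentiable f x) /\
             (forall v, Ck k' U (fun x => 'D_v f x))
  end.

Definition smooth_on (R : realType) (V W : normedModType R) (U : set V)
  (f : V -> W) : Prop := forall k, Ck k U f.

Section SmoothTheory.
Context {R : realType} {V : normedModType R}.

Lemma near_eq_differentiable (W : normedModType R) (f g : V -> W) (x : V) :
  {near x, f =1 g} -> differentiable f x -> differentiable g x.
Proof.
move=> fg /diff_locallyP[dc df].
have gE : g \o shift x = cst (g x) + 'd f x +o_ 0 id.
  apply/eqaddoP => e e0.
  move/eqaddoP : df => /(_ e e0) H.
  have sx : (fun h : V => h + x) @ 0 --> x.
    by rewrite -[X in _ --> X]add0r; apply: cvgD; [exact: cvg_id|exact: cvg_cst].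
  have fg0 : \forall h \near (0 : V), f (h + x) = g (h + x) by exact: (sx _ fg).
  near=> h.
  have fgh : f (h + x) = g (h + x) by near: h.
  rewrite /= -(nbhs_singleton fg).
  have : `|(f \o shift x - (cst (f x) + 'd f x)) h| <= e * `|h| by near: h.
  by rewrite /= !fctE /= fgh.
by apply/diff_locallyP; rewrite (diff_unique dc gE).
Unshelve. all: by end_near. Qed.

Variables (U : set V) (oU : open U).
Implicit Types f g : V -> R.

Lemma eq_Ck k f g : (forall x, U x -> f x = g x) -> Ck k U f -> Ck k U g.
Proof.
have nearU h l x : (forall y, U y -> h y = l y) -> U x ->
    \forall y \near x, h y = l y :> R.
  by move=> hl Ux; apply: filterS hl _; exact: open_nbhs_nbhs.
elim: k f g => [|k IH] f g fg /=.
  move=> fc x Ux; rewrite /prop_for /continuous_at -fg//.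
  apply: cvg_trans (fc x Ux); apply: near_eq_cvg; exact: nearU.
move=> [df Df]; split=> [x Ux|v].
  by apply: near_eq_differentiable (df x Ux); exact: nearU.
apply: IH (Df v) => x Ux /=; apply: near_eq_derive; exact: nearU.
Qed.

Lemma CkW k f : Ck k.+1 U f -> Ck k U f.
Proof.
elim: k f => [|k IH] f [df Df] /=.
  by move=> x Ux; exact/differentiable_continuous/df.
by split=> // v; exact: IH.
Qed.

Lemma Ck_cst k (a : R) : Ck k U (cst a).
Proof.
elim: k a => [|k IH] a /=; first by move=> x _; exact: cvg_cst.
split=> [x _|v]; first exact: differentiable_cst.
by apply: eq_Ck (IH 0) => x Ux /=; rewrite derive_cst.
Qed.

Lemma CkD k f g : Ck k U f -> Ck k U g -> Ck k U (f + g).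
Proof.
elim: k f g => [|k IH] f g /=.
  by move=> fc gc x Ux; apply: cvgD; [exact: fc|exact: gc].
move=> [df Df] [dg Dg]; split=> [x Ux|v].
  by apply: differentiableD; [exact: df|exact: dg].
apply: eq_Ck (IH _ _ (Df v) (Dg v)) => x Ux /=.
by rewrite deriveD//; apply: diff_derivable; [exact: df|exact: dg].
Qed.

Lemma CkM k f g : Ck k U f -> Ck k U g -> Ck k U (f * g).
Proof.
elim: k f g => [|k IH] f g.
  by move=> fc gc x Ux; apply: cvgM; [exact: fc|exact: gc].
move=> fk gk; have [df Df] := fk; have [dg Dg] := gk.
split=> [x Ux|v].
  by apply: differentiableM; [exact: df|exact: dg].
apply: eq_Ck (CkD (IH _ _ (CkW fk) (Dg v)) (IH _ _ (CkW gk) (Df v))) => x Ux /=.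
by rewrite deriveM//; apply: diff_derivable; [exact: df|exact: dg].
Qed.

End SmoothTheory.

(* [chart_inv] is only relevant on the image of [chart_dom]. *)
Record chart (R : realType) (m : nat) (T : topologicalType) := Chart {
  chart_dom : set T ;
  chart_map : T -> 'rV[R]_m ;
  chart_inv : 'rV[R]_m -> T ;
  chart_dom_open : open chart_dom ;
  chart_img_open : open (chart_map @` chart_dom) ;
  chart_mapK : forall p, chart_dom p -> chart_inv (chart_map p) = p ;
  chart_map_cont : forall p, chart_dom p -> {for p, continuous chart_map} ;
  chart_inv_cont : forall u, (chart_map @` chart_dom) u ->
    {for u, continuous chart_inv}
}.

Record manifold (R : realType) (m : nat) := Manifold {
  carrier :> topologicalType ;
  atlas : set (chart R m carrier) ;
  carrier_hausdorff : hausdorff_space carrier ;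
  carrier_second_countable : @second_countable carrier ;
  atlas_cover : forall p : carrier, exists2 c, atlas c & chart_dom c p ;
  atlas_smooth : forall c c', atlas c -> atlas c' ->
    smooth_on (chart_map c @` (chart_dom c `&` chart_dom c'))
              (chart_map c' \o chart_inv c)
}.

Section SmoothFunctions.
Context {R : realType} {m : nat} (M : manifold R m).

Definition smooth (f : M -> R) : Prop := forall c, atlas c ->
  smooth_on (chart_map c @` chart_dom c) (f \o chart_inv c).

Definition smooth_pred : {pred (M -> R)} := fun f => `[< smooth f >].

Lemma smooth_subring_closed : subring_closed smooth_pred.
Proof.
split=> [|f g|f g]; rewrite !unfold_in.
- by apply/asboolP => c _ k; apply: Ck_cst; exact: chart_img_open.
- move=> /asboolP sf /asboolP sg; apply/asboolP => c Ac k.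
  have oc : open (chart_map c @` chart_dom c) by exact: chart_img_open.
  have -> : (f - g) \o chart_inv c =
      (f \o chart_inv c) + (cst (-1) * (g \o chart_inv c)) :> (_ -> R).
    by apply/funext => u /=; rewrite !fctE/= mulN1r.
  apply: CkD => //; first exact: sf.
  by apply: CkM => //; [exact: Ck_cst|exact: sg].
- move=> /asboolP sf /asboolP sg; apply/asboolP => c Ac k.
  by apply: CkM; [exact: chart_img_open|exact: sf|exact: sg].
Qed.

HB.instance Definition _ :=
  GRing.isSubringClosed.Build _ smooth_pred smooth_subring_closed.

Lemma smooth_scaler_closed : GRing.scaler_closed smooth_pred.
Proof.
move=> a f; rewrite !unfold_in => /asboolP sf; apply/asboolP => c Ac k.
apply: (@CkM _ _ _ _ k (cst a)); first exact: chart_img_open.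
  by apply: Ck_cst; exact: chart_img_open.
exact: sf.
Qed.

HB.instance Definition _ :=
  GRing.isScaleClosed.Build R (M -> R) smooth_pred smooth_scaler_closed.

Record smooth_fun := SmoothFun {
  smooth_val :> M -> R ;
  smooth_valP : smooth_val \in smooth_pred
}.

HB.instance Definition _ := [isSub of smooth_fun for smooth_val].
HB.instance Definition _ := [Choice of smooth_fun by <:].
HB.instance Definition _ := GRing.SubChoice_isSubComPzRing.Build _ smooth_pred
  smooth_fun smooth_subring_closed.
HB.instance Definition _ := [SubZmodule_isSubLmodule of smooth_fun by <:].

End SmoothFunctions.

Notation "''C^oo' ( M )" := (smooth_fun M) (format "''C^oo' ( M )").

Section VectorFields.
Context {R : realType} {m : nat} (M : manifold R m).

Record vfield := VField {
  vfield_val :> 'C^oo(M) -> 'C^oo(M) ;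
  vfield_linear : linear (vfield_val : 'C^oo(M) -> 'C^oo(M)) ;
  vfield_leibniz : forall f h,
    vfield_val (f * h) = vfield_val f * h + f * vfield_val h
}.

HB.instance Definition _ := gen_eqMixin vfield.
HB.instance Definition _ := gen_choiceMixin vfield.

Lemma vfieldP (X Y : vfield) : (forall f, X f = Y f) -> X = Y.
Proof.
case: X Y => [X lX pX] [Y lY pY] /= XY; have {}XY : X = Y by exact/funext.
by subst Y; congr VField; exact: Prop_irrelevance.
Qed.

Fact vfield_add_linear (X Y : vfield) : linear (fun f => X f + Y f).
Proof.
move=> a f h; rewrite !vfield_linear scalerDr !addrA; congr (_ + _).
by rewrite -!addrA; congr (_ + _); rewrite addrC.
Qed.
Fact vfield_add_leibniz (X Y : vfield) f h :
  X (f * h) + Y (f * h) = (X f + Y f) * h + f * (X h + Y h).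
Proof. by rewrite !vfield_leibniz mulrDl mulrDr addrACA. Qed.
Definition vfield_add X Y :=
  VField (@vfield_add_linear X Y) (vfield_add_leibniz X Y).

Lemma smooth_scalerAl (a : R) (f h : 'C^oo(M)) : a *: (f * h) = (a *: f) * h.
Proof. by apply/val_inj/funext => p; exact: mulrA. Qed.
Lemma smooth_scalerAr (a : R) (f h : 'C^oo(M)) : a *: (f * h) = f * (a *: h).
Proof. by rewrite mulrC smooth_scalerAl mulrC. Qed.

Fact vfield_scale_linear (l : 'C^oo(M)) (X : vfield) :
  linear (fun f => l * X f).
Proof. by move=> a f h; rewrite vfield_linear mulrDr smooth_scalerAr. Qed.
Fact vfield_scale_leibniz (l : 'C^oo(M)) (X : vfield) f h :
  l * X (f * h) = (l * X f) * h + f * (l * X h).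
Proof. by rewrite vfield_leibniz mulrDr mulrA (mulrCA f). Qed.
Definition vfield_scale l X :=
  VField (@vfield_scale_linear l X) (vfield_scale_leibniz l X).

Fact vfield_zero_linear : linear (fun _ : 'C^oo(M) => 0 : 'C^oo(M)).
Proof. by move=> a f h; rewrite scaler0 addr0. Qed.
Fact vfield_zero_leibniz (f h : 'C^oo(M)) : 0 = 0 * h + f * 0.
Proof. by rewrite mul0r mulr0 addr0. Qed.
Definition vfield_zero := VField vfield_zero_linear vfield_zero_leibniz.

Definition vfield_opp (X : vfield) := vfield_scale (-1) X.

Fact vfield_addA : associative vfield_add.
Proof. by move=> X Y Z; apply: vfieldP => f /=; rewrite addrA. Qed.
Fact vfield_addC : commutative vfield_add.
Proof. by move=> X Y; apply: vfieldP => f /=; rewrite addrC. Qed.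
Fact vfield_add0 : left_id vfield_zero vfield_add.
Proof. by move=> X; apply: vfieldP => f /=; rewrite add0r. Qed.
Fact vfield_addN : left_inverse vfield_zero vfield_opp vfield_add.
Proof. by move=> X; apply: vfieldP => f /=; rewrite mulN1r addNr. Qed.

HB.instance Definition _ := GRing.isZmodule.Build vfield
  vfield_addA vfield_addC vfield_add0 vfield_addN.

Fact vfield_scaleA (a b : 'C^oo(M)) (X : vfield) :
  vfield_scale a (vfield_scale b X) = vfield_scale (a * b) X.
Proof. by apply: vfieldP => f /=; rewrite mulrA. Qed.
Fact vfield_scale1 : left_id 1 vfield_scale.
Proof. by move=> X; apply: vfieldP => f /=; rewrite mul1r. Qed.
Fact vfield_scaleDr : right_distributive vfield_scale +%R.
Proof. by move=> a X Y; apply: vfieldP => f /=; rewrite mulrDr. Qed.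
Fact vfield_scaleDl (X : vfield) :
  {morph vfield_scale^~ X : a b / a + b}.
Proof. by move=> a b; apply: vfieldP => f /=; rewrite mulrDl. Qed.

HB.instance Definition _ := GRing.Zmodule_isLmodule.Build 'C^oo(M) vfield
  vfield_scaleA vfield_scale1 vfield_scaleDr vfield_scaleDl.

Fact bracket_linear (X Y : vfield) : linear (fun f => X (Y f) - Y (X f)).
Proof.
move=> a f h; rewrite !vfield_linear scalerBr opprD.
by rewrite addrACA.
Qed.
Fact bracket_leibniz (X Y : vfield) f h :
  X (Y (f * h)) - Y (X (f * h)) =
  (X (Y f) - Y (X f)) * h + f * (X (Y h) - Y (X h)).
Proof.
have addE (Z : vfield) u v : Z (u + v) = Z u + Z v.
  by have := vfield_linear Z 1 u v; rewrite !scale1r.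
rewrite !(vfield_leibniz, addE) mulrBl mulrBr.
suff aux (a b c d e k : 'C^oo(M)) :
  a + b + (c + d) - (e + c + (b + k)) = a - e + (d - k) by exact: aux.
rewrite (addrC c) (addrACA a) (addrC b k) (addrACA e) (addrC c b).
by rewrite [e + k + _]addrC addrKA opprD addrACA.
Qed.
Definition bracket X Y := VField (@bracket_linear X Y) (bracket_leibniz X Y).

End VectorFields.

Notation "''Vect' ( M )" := (vfield M) (format "''Vect' ( M )").

Section Geometry.
Context {R : realType} {m : nat} {M : manifold R m}.
Implicit Types (X Y Z V : 'Vect(M)) (f : 'C^oo(M)) (p : M).

Record riemannian_metric (g : 'Vect(M) -> 'Vect(M) -> 'C^oo(M)) : Prop := {
  metric_linear : forall Y, scalar (g^~ Y) ;
  metric_sym : forall X Y, g X Y = g Y X ;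
  metric_pos : forall X p, (exists f, X f p != 0) -> 0 < g X X p
}.

Record affine_connection (nabla : 'Vect(M) -> 'Vect(M) -> 'Vect(M)) : Prop := {
  connection_linear : forall Y, linear (nabla^~ Y) ;
  connection_add : forall X Y Z, nabla X (Y + Z) = nabla X Y + nabla X Z ;
  connection_leibniz : forall X f Y,
    nabla X (f *: Y) = X f *: Y + f *: nabla X Y
}.

Record levi_civita (g : 'Vect(M) -> 'Vect(M) -> 'C^oo(M))
    (nabla : 'Vect(M) -> 'Vect(M) -> 'Vect(M)) : Prop := {
  lc_connection : affine_connection nabla ;
  lc_torsion_free : forall X Y, nabla X Y - nabla Y X = bracket X Y ;
  lc_metric : forall X Y Z, Z (g X Y) = g (nabla Z X) Y + g X (nabla Z Y)
}.

Definition curvature (nabla : 'Vect(M) -> 'Vect(M) -> 'Vect(M)) X Y Z :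
    'Vect(M) :=
  nabla X (nabla Y Z) - nabla Y (nabla X Z) - nabla (bracket X Y) Z.

Definition orthonormal_at (g : 'Vect(M) -> 'Vect(M) -> 'C^oo(M)) p
  (e : 'I_m -> 'Vect(M)) : Prop := forall i j, g (e i) (e j) p = (i == j)%:R.

(* S(X, Y) is the trace of Z |-> R(Z, X)Y, computed at each point in any family
   of m vector fields that is orthonormal at that point. *)
Definition ricci_tensor (g : 'Vect(M) -> 'Vect(M) -> 'C^oo(M))
    (nabla : 'Vect(M) -> 'Vect(M) -> 'Vect(M))
    (S : 'Vect(M) -> 'Vect(M) -> 'C^oo(M)) : Prop :=
  forall p e, orthonormal_at g p e -> forall X Y,
    S X Y p = \sum_(i < m) g (curvature nabla (e i) X Y) (e i) p.

Definition lie_derivative V (g : 'Vect(M) -> 'Vect(M) -> 'C^oo(M)) X Y :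
    'C^oo(M) :=
  V (g X Y) - g (bracket V X) Y - g X (bracket V Y).

End Geometry.

Record almost_contact_metric (R : realType) (m : nat) (M : manifold R m) := {
  acm_g : 'Vect(M) -> 'Vect(M) -> 'C^oo(M) ;
  acm_phi : {linear 'Vect(M) -> 'Vect(M)} ;
  acm_xi : 'Vect(M) ;
  acm_eta : {scalar 'Vect(M)} ;
  acm_metric : riemannian_metric acm_g ;
  acm_phi2 : forall X, acm_phi (acm_phi X) = - X + acm_eta X *: acm_xi ;
  acm_eta_xi : acm_eta acm_xi = 1 ;
  acm_etaE : forall X, acm_eta X = acm_g X acm_xi ;
  acm_phi_g : forall X Y,
    acm_g (acm_phi X) (acm_phi Y) = acm_g X Y - acm_eta X * acm_eta Y
}.

Section Kenmotsu.
Context {R : realType} {m : nat} {M : manifold R m}.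
Variable A : almost_contact_metric M.
Let g := acm_g A.
Let phi := acm_phi A.
Let xi := acm_xi A.
Let eta := acm_eta A.

(* The left-hand side is (nabla_X phi) Y. *)
Definition kenmotsu (nabla : 'Vect(M) -> 'Vect(M) -> 'Vect(M)) : Prop :=
  forall X Y,
  nabla X (phi Y) - phi (nabla X Y) = g (phi X) Y *: xi - eta Y *: phi X.

Definition eta_einstein (S : 'Vect(M) -> 'Vect(M) -> 'C^oo(M)) : Prop :=
  exists alpha beta : 'C^oo(M), forall X Y,
    S X Y = alpha * g X Y + beta * (eta X * eta Y).

Definition einstein (S : 'Vect(M) -> 'Vect(M) -> 'C^oo(M)) : Prop :=
  exists alpha : 'C^oo(M), forall X Y, S X Y = alpha * g X Y.

(* [m] is the dimension, so that 2 / m is 2 / (2n + 1) when m = 2n + 1. *)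
Definition conformal_eta_ricci_soliton (S : 'Vect(M) -> 'Vect(M) -> 'C^oo(M))
    (p : R) (V : 'Vect(M)) (lambda mu : R) : Prop := forall X Y,
  lie_derivative V g X Y + 2 *: S X Y
    + (2 * lambda - (p + 2 / m%:R)) *: g X Y
    + (2 * mu) *: (eta X * eta Y) = 0.

End Kenmotsu.

(* Main.v *)
Require Import Defs.
From HB Require Import structures.
From mathcomp Require Import all_boot all_order all_algebra.
From mathcomp Require Import all_classical all_reals all_analysis.
From mathcomp Require Import ring lra.

Set Implicit Arguments.
Unset Strict Implicit.
Unset Printing Implicit Defensive.
Import Order.TTheory GRing.Theory Num.Theory.
Import numFieldNormedType.Exports.
Local Open Scope ring_scope.

(* All computations take place in the algebra of smooth functions.  The Kenmotsu
   condition enters only through nabla_X xi = X - eta(X) xi and through phi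
   rotating the horizontal distribution.  Write S = alpha g + beta eta (x) eta
   and hor = g - eta (x) eta; the aim is beta = 0.

   The trace of the Lie derivative of the curvature along xi gives
   xi(beta) = -2 beta.  For the soliton field V put f = eta(V).  The soliton
   equation makes grad f equal to [V, xi] up to a constant multiple k of xi, and
   differentiating it along xi gives k = 0 and
     Hess f = 2 beta hor - df (x) eta - eta (x) df.
   Tracing the curvature on grad f relates d(beta) to beta df.  The field
   W = V - f xi - (grad f) / 2 acts conformally on the leaves of eta = 0, so
   Hess (W f) is known as well, and tracing the curvature on grad (W f) yields
   beta (W f + affine function of f) df = 0.  Where beta df is not zero, W f is
   therefore an affine function of f; comparing the two Hessians shows that
   df (x) df is proportional to hor, which is impossible as the horizontal
   distribution has rank at least 2.  So beta df = 0, hence beta^2 Hess f = 0 and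
   beta^3 = 0.

   The traces need orthonormal frames.  Bump functions produce as many independent
   vector fields at a point as the dimension; that there are no more is deduced
   from the Ricci tensor itself, see [rank_bound]. *)

Lemma eq_of_sub (V : zmodType) (a b x y : V) : x = y -> a - b = x - y -> a = b.
Proof. by move=> -> /eqP; rewrite subrr subr_eq0 => /eqP. Qed.

(** * Bump functions and coordinate vector fields *)

Section Flat.
Local Open Scope classical_set_scope.
Context {R : realType}.
Implicit Types (t : R) (n : nat).

(** The classical smooth function exp(-1/t), with the factor t^-n added so that the family is stable
    under differentiation; smoothness then follows by one induction for all [n]. *)
Definition flat n t : R := if 0 < t then t^-1 ^+ n * expR (- t^-1) else 0.

Lemma flat_ge0 n t : 0 <= flat n t.
Proof.
rewrite /flat; case: ifP => // t0.
by rewrite mulr_ge0 ?expR_ge0 ?exprn_ge0 ?invr_ge0 ?ltW.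
Qed.

Lemma flat0_gt0 t : 0 < t -> 0 < flat 0 t.
Proof. by move=> t0; rewrite /flat t0 expr0 mul1r expR_gt0. Qed.

Lemma flat_le0 n t : t <= 0 -> flat n t = 0.
Proof. by rewrite /flat leNgt => /negbTE ->. Qed.

(** Comes from x^(n+1)/(n+1)! <= exp x at x = 1/t. Decay at least linear at 0 is what makes the
    difference quotients at 0 converge. *)
Lemma flat_bound n t : flat n t <= (n.+1)`!%:R * `|t|.
Proof.
case: (ltP 0 t) => [t0|t0]; last by rewrite flat_le0 // mulr_ge0.
rewrite /flat t0 gtr0_norm //.
have x0 : 0 < t^-1 by rewrite invr_gt0.
have := expR_ge1Dxn n (ltW x0); set F := (_`!)%:R; set x := t^-1 in x0 *.
have F0 : 0 < F :> R by rewrite ltr0n fact_gt0.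
move=> H; have {}H : x ^+ n.+1 / F <= expR x by lra.
rewrite expRN ler_pdivrMr ?expR_gt0 //.
rewrite ler_pdivrMr // in H.
have -> : t = x^-1 by rewrite invrK.
rewrite mulrAC ler_pdivlMr // -exprSr.
by rewrite mulrC.
Qed.

Lemma is_derive_flat n t :
  is_derive t 1 (flat n) (flat n.+2 t - n%:R * flat n.+1 t).
Proof.
case: (ltrgtP 0 t) => [t0|t0|<-].
- have tn : t != 0 by rewrite gt_eqF.
  apply: (@near_eq_is_derive _ R^o R^o (fun s => s^-1 ^+ n * expR (- s^-1)) (flat n)).
    have : \forall s \near t, 0 < s by exact: lt_nbhsr.
    by apply: filterS => s s0; rewrite /flat s0.
  have H : is_derive t 1 (fun s : R => s^-1) (- t^-1 ^+ 2).
    apply: DeriveDef; first exact: derivableV.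
    by rewrite deriveV // derive_id [_ *: _]mulr1 exprVn.
  have -> : (fun s => s^-1 ^+ n * expR (- s^-1)) = (fun s : R => s^-1) ^+ n
     * (expR \o (fun s => - s^-1)).
    by apply/funext => s; rewrite !fctE.
  apply: is_derive_eq.
  rewrite /flat t0 /GRing.scale /= !fctE opprK.
  case: n => [|n] /=; rewrite ?mul0r ?mulr0 ?addr0 ?subr0 ?expr0 ?mul1r.
    by rewrite mulrC.
  by rewrite /= !exprS -mulr_natr; ring.
- rewrite !flat_le0 ?ltW // mulr0 subr0.
  apply: (@near_eq_is_derive _ R^o R^o (cst 0) (flat n)).
    have : \forall s \near t, s < 0 by exact: lt_nbhsl.
    by apply: filterS => s s0; rewrite flat_le0 // ltW.
- rewrite !flat_le0 // mulr0 subr0.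
  suff H : (fun h => h^-1 *: ((flat n \o shift 0) (h *: (1:R)) - flat n 0)) @
    (0:R)^' --> (0 : R).
    by apply: DeriveDef; [apply/cvg_ex; exists 0|exact: cvg_lim].
  (* The difference quotient of [flat n] at 0 is [flat n.+1], which [flat_bound] squeezes to 0. *)
  have E : \forall h \near (0:R)^', flat n.+1 h = h^-1 *: ((flat n \o shift 0) (h
    *: (1:R)) - flat n 0).
    near=> h.
    rewrite /= addr0 [h *: _]mulr1 (@flat_le0 _ 0) // subr0 /flat /GRing.scale /=.
    by case: ifP; rewrite ?mulr0 // exprS mulrA.
  apply: cvg_trans (near_eq_cvg E) _.
  apply: cvg_within_filter.
  have H : (fun h : R => `|h|) @ (0 : R) --> `|0 : R| by exact: norm_continuous.
  have {}H := cvgMl_tmp (a := (n.+2)`!%:R) H.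
  apply: (@squeeze_cvgr _ _ _ _ (cst 0) (fun h => (n.+2)`!%:R * `|h|)).
  - by near=> h; rewrite flat_ge0 flat_bound.
  - exact: cvg_cst.
  - move: H; rewrite normr0 mulr0 => H; exact: H.
Unshelve. all: by end_near. Qed.

End Flat.

Section CkExtra.
Local Open Scope classical_set_scope.
Context {R : realType} {V : normedModType R}.
Implicit Types (U : set V) (k : nat).

(** [Ck] concerns [f] itself at each point of the set, not a restriction of [f], so the condition is
    pointwise and any set [B] through the point serves. *)
Lemma Ck_local (W : normedModType R) U k (f : V -> W) :
  (forall x, U x -> exists2 B, B x & Ck k B f) -> Ck k U f.
Proof.
elim: k f => [|k IH] f /= H.
  by move=> x /H [B Bx HO]; exact: HO.
split=> [x /H [B Bx [df _]]|v]; first exact: df.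
by apply: IH => x /H [B Bx [_ Df]]; exists B.
Qed.

Lemma Ck_pred (W : normedModType R) U k (f : V -> W) : Ck k.+1 U f -> Ck k U f.
Proof.
elim: k f => [|k IH] f [df Df] /=.
  by move=> x Ux; exact/differentiable_continuous/df.
by split=> // v; exact: IH.
Qed.

Lemma Ck_sum U (oU : open U) k (I : Type) (s : seq I) (F : I -> V -> R) :
  (forall i, Ck k U (F i)) -> Ck k U (fun x => \sum_(i <- s) F i x).
Proof.
move=> HF; elim: s => [|i s IH].
  by apply: (eq_Ck oU _ (Ck_cst oU k 0)) => x _; rewrite big_nil.
by apply: (eq_Ck oU _ (CkD oU (HF i) IH)) => x _; rewrite big_cons.
Qed.

Lemma Ck_coord U (oU : open U) k m (F : V -> 'rV[R]_m) j :
  Ck k U F -> Ck k U (fun x => F x 0 j).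
Proof.
elim: k F => [|k IH] F /=.
  move=> Fc x Ux; apply: (@continuous_comp _ _ _ F (fun N : 'rV_m => N 0 j)).
    exact: Fc.
  exact: coord_continuous.
move=> [dF DF]; split=> [x Ux|v].
  exact: (differentiable_comp (dF x Ux) (differentiable_coord _ _ _)).
apply: (eq_Ck oU _ (IH _ (DF v))) => x Ux.
by rewrite derive_mx ?mxE//; exact/diff_derivable/dF.
Qed.

End CkExtra.

Lemma Ck_projection (R : realType) m (j : 'I_m) (U : set 'rV[R]_m) (oU : open U) k :
  Ck k U (fun u : 'rV[R]_m => u 0 j).
Proof.
case: k => [|k]; first by move=> x _; exact: coord_continuous.
split=> [x _|v]; first exact: differentiable_coord.
apply: (eq_Ck oU _ (Ck_cst oU k (v 0 j))) => x _ /=.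
have := derive_mx (@derivable_id R 'rV[R]_m x v).
by rewrite derive_id => {1}->; rewrite mxE.
Qed.

(** By the chain rule a derivative is a sum of components of the derivative of [F] times partial
    derivatives of [h] composed with [F]; induction covers the latter. *)
Lemma Ck_comp (R : realType) (V : normedModType R) m (U : set V) (oU : open U)
    (U' : set 'rV[R]_m) (oU' : open U') k (F : V -> 'rV[R]_m) (h : 'rV[R]_m -> R) :
  (forall x, U x -> U' (F x)) -> Ck k U F -> Ck k U' h -> Ck k U (h \o F).
Proof.
move=> UF; elim: k h => [|k IH] h.
  by move=> /= Fc hc x Ux; apply: continuous_comp; [exact: Fc|exact/hc/UF].
move=> Fk [dh Dh]; have [dF DF] := Fk; split=> [x Ux|v].
  by apply: differentiable_comp; [exact: dF|apply: dh; exact: UF].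
have H : Ck k U (fun x => \sum_(j < m)
    ('D_v F x 0 j * 'D_(delta_mx 0 j) h (F x))).
  apply: Ck_sum => // j; apply: CkM => //; first exact: (Ck_coord oU j (DF v)).
  by apply: IH (Dh _); exact: Ck_pred.
apply: (eq_Ck oU _ H) => x Ux.
have dFx := dF x Ux; have dhx := dh _ (UF _ Ux).
have E : 'd F x v = \sum_j 'D_v F x 0 j *: delta_mx 0 j.
  by rewrite -(deriveE v dFx) -row_sum_delta.
rewrite [RHS]deriveE; last exact: differentiable_comp.
rewrite diff_comp //; transitivity ('d h (F x) ('d F x v)); last by [].
rewrite E linear_sum; apply: eq_bigr => j _.
by rewrite linearZ (deriveE (delta_mx 0 j) dhx).
Qed.

Lemma Ck_flat (R : realType) (V : normedModType R) (U : set V) (oU : open U) k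
    (q : V -> R) n : smooth_on U q -> Ck k U (flat n \o q).
Proof.
move=> Sq; elim: k n => [|k IH] n.
  move=> x Ux; apply: continuous_comp; first exact: (Sq 0%N).
  apply: differentiable_continuous; apply/derivable1_diffP.
  by case: (is_derive_flat n (q x)).
have dq x : U x -> differentiable q x by move=> Ux; have [d _] := Sq 1%N; exact: d.
have df t : differentiable (flat n : R -> R) t.
  by apply/derivable1_diffP; case: (is_derive_flat n t).
split=> [x Ux|v]; first by apply: differentiable_comp; [exact: dq|exact: df].
have H : Ck k U ('D_v q * ((flat n.+2 \o q) + cst (- n%:R) * (flat n.+1 \o q))).
  apply: CkM => //; first by have [_ d] := Sq k.+1; exact: d.
  by apply: CkD => //; apply: CkM => //; exact: Ck_cst.
apply: (eq_Ck oU _ H) => x Ux.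
have dqx := dq x Ux; have dfx := df (q x).
rewrite [RHS]deriveE; last exact: differentiable_comp.
rewrite (diff_comp dqx dfx).
have [dv D] := is_derive_flat n (q x).
transitivity ('d (flat n : R -> R) (q x) ('d q x v)); last by [].
rewrite (deriv1E dv) derive1E D -(deriveE v dqx).
by rewrite !fctE /= mulNr.
Qed.

(** * Extending functions and fields from a chart by zero *)

Section ChartExtension.
Local Open Scope classical_set_scope.
Context {R : realType} {m : nat} {M : manifold R m}.
Implicit Types (c : chart R m M) (h : 'rV[R]_m -> R) (K : set 'rV[R]_m).

Local Notation img c := (chart_map c @` chart_dom c).

Lemma open_chart_img c (B : set M) : open B ->
  open (chart_map c @` (chart_dom c `&` B)).
Proof.
move=> oB; rewrite openE => _ [q [cq Bq] <-].
have iq : img c (chart_map c q) by exists q.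
have n1 : nbhs (chart_map c q) (img c).
  by apply: open_nbhs_nbhs; split=> //; exact: chart_img_open.
have n2 : nbhs (chart_map c q) (chart_inv c @^-1` B).
  apply: (chart_inv_cont iq); rewrite chart_mapK //.
  exact: open_nbhs_nbhs.
apply: filterS (filterI n1 n2) => _ [[q' cq' <-]] /=.
by rewrite chart_mapK // => Bq'; exists q'.
Qed.

Definition extend c h (q : M) : R :=
  if `[< chart_dom c q >] then h (chart_map c q) else 0.

Lemma extendE c h q : chart_dom c q -> extend c h q = h (chart_map c q).
Proof. by move=> cq; rewrite /extend asboolT. Qed.

(** The image of [K] in the manifold is compact, hence closed by the Hausdorff property. The chart
    domain and the complement of this image form an open cover: on the first the function is [h]
    through a transition map, on the second it is 0. *)
Lemma smooth_extend c h K : atlas c -> compact K -> K `<=` img c ->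
  smooth_on (img c) h -> (forall u, ~ K u -> h u = 0) -> smooth (extend c h).
Proof.
move=> Ac cK Kc sh h0 c' Ac' k.
pose L := chart_inv c @` K.
have cL : closed L.
  apply: compact_closed; first exact: carrier_hausdorff.
  apply: continuous_compact cK; apply: continuous_in_subspaceT => u.
  by rewrite inE => /Kc; exact: chart_inv_cont.
apply: Ck_local => _ [q c'q <-].
have [cq|cq] := pselect (chart_dom c q).
  pose B := chart_map c' @` (chart_dom c' `&` chart_dom c).
  have oB : open B by apply: open_chart_img; exact: chart_dom_open.
  exists B; first by exists q.
  have Bc u : B u -> img c ((chart_map c \o chart_inv c') u).
    by move=> [q' [c'q' cq'] <-]; exists q' => //=; rewrite chart_mapK.
  have ot : open (img c) by exact: chart_img_open.
  apply: (eq_Ck oB _ (Ck_comp oB ot Bc (atlas_smooth Ac' Ac k) (sh k))).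
  by move=> _ [q' [c'q' cq'] <-] /=; rewrite chart_mapK // extendE.
pose B := chart_map c' @` (chart_dom c' `&` ~` L).
have oB : open B by apply: open_chart_img; exact: closed_openC.
exists B.
  exists q => //; split=> // -[u Ku]; have [q' cq' <-] := Kc _ Ku.
  by rewrite chart_mapK // => q'q; apply: cq; rewrite -q'q.
apply: (eq_Ck oB _ (Ck_cst oB k 0)) => _ [q' [c'q' Lq'] <-] /=.
rewrite chart_mapK // /extend; case: asboolP => // cq'.
rewrite h0 // => Kq'; apply: Lq'; exists (chart_map c q') => //.
by rewrite chart_mapK.
Qed.

Lemma smooth_onP c h : smooth_on (img c) h -> forall u v, img c u -> derivable h u v.
Proof. by move=> /(_ 1%N)[dh _] u v iu; apply: diff_derivable; exact: dh. Qed.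

Lemma smoothD (f h : 'C^oo(M)) q : (f + h) q = f q + h q. Proof. by []. Qed.
Lemma smoothN (f : 'C^oo(M)) q : (- f) q = - f q. Proof. by []. Qed.
Lemma smoothM (f h : 'C^oo(M)) q : (f * h) q = f q * h q. Proof. by []. Qed.
Lemma smoothZ a (f : 'C^oo(M)) q : (a *: f) q = a * f q. Proof. by []. Qed.
Lemma smooth0 q : (0 : 'C^oo(M)) q = 0. Proof. by []. Qed.
Lemma smooth1 q : (1 : 'C^oo(M)) q = 1. Proof. by []. Qed.

Lemma smooth_funE (f h : 'C^oo(M)) : f =1 h -> f = h.
Proof. by move=> fh; apply/val_inj/funext. Qed.

Definition smooth_fun_of (f : M -> R) (sf : smooth f) : 'C^oo(M) :=
  @SmoothFun _ _ _ f (asboolT sf).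

Lemma smooth_funP (f : 'C^oo(M)) c : atlas c -> smooth_on (img c) (f \o chart_inv c).
Proof. by move=> Ac; have /asboolP := smooth_valP f; exact. Qed.

Section CoordinateField.
Variables (c : chart R m M) (Ac : atlas c) (K : set 'rV[R]_m).
Hypotheses (cK : compact K) (Kc : K `<=` img c).
Variables (psi : 'rV[R]_m -> R) (spsi : smooth_on (img c) psi).
Hypothesis (psi0 : forall u, ~ K u -> psi u = 0).
Variable v : 'rV[R]_m.

(** A coordinate derivative times the cutoff [psi], so that it extends by zero to a global
    derivation. *)
Let D (f : 'C^oo(M)) u := psi u * 'D_v (f \o chart_inv c) u.

Fact coord_field_smooth f : smooth (extend c (D f)).
Proof.
apply: (smooth_extend Ac cK Kc) => [k|u Ku]; last by rewrite /D psi0 // mul0r.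
have [_ Df] := smooth_funP f Ac k.+1.
by apply: CkM; [exact: chart_img_open|exact: spsi|exact: Df].
Qed.

Fact coord_field_linear : linear (fun f => smooth_fun_of (coord_field_smooth f)).
Proof.
move=> a f h; apply: smooth_funE => q.
rewrite smoothD smoothZ /= /extend; case: asboolP => cq; last by rewrite mulr0 addr0.
have iq : img c (chart_map c q) by exists q.
have df := smooth_onP (smooth_funP f Ac) iq.
have dh := smooth_onP (smooth_funP h Ac) iq.
rewrite /D (_ : _ \o _ = a *: (f \o chart_inv c) + (h \o chart_inv c)) //.
by rewrite deriveD ?deriveZ //; [rewrite mulrDr mulrCA|exact: derivableZ].
Qed.

Fact coord_field_leibniz (f h : 'C^oo(M)) : smooth_fun_of (coord_field_smooth (f * h)) =
  smooth_fun_of (coord_field_smooth f) * h + f * smooth_fun_of (coord_field_smooth h).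
Proof.
apply: smooth_funE => q.
rewrite smoothD !smoothM /= /extend; case: asboolP => cq; last by rewrite mulr0
  mul0r addr0.
have iq : img c (chart_map c q) by exists q.
have df := smooth_onP (smooth_funP f Ac) iq.
have dh := smooth_onP (smooth_funP h Ac) iq.
rewrite /D (_ : _ \o _ = (f \o chart_inv c) * (h \o chart_inv c)) //.
rewrite (deriveM (df v) (dh v)) /= chart_mapK // /GRing.scale /=; ring.
Qed.

Definition coord_field : 'Vect(M) := VField coord_field_linear coord_field_leibniz.

Lemma coord_fieldE f q : chart_dom c q ->
  coord_field f q = psi (chart_map c q) * 'D_v (f \o chart_inv c) (chart_map c q).
Proof. exact: extendE. Qed.

End CoordinateField.

(** [K] is a closed cube, a ball of the sup norm, of half the radius available in the chart image.
    It contains the Euclidean ball on which flat 0 (r^2 - |u - a|^2) is positive. *)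
Lemma exists_bump c (p : M) : chart_dom c p -> exists K (psi : 'rV[R]_m -> R),
  [/\ compact K, K `<=` img c, forall U, open U -> smooth_on U psi,
      forall u, ~ K u -> psi u = 0 & 0 < psi (chart_map c p)].
Proof.
move=> cp; set a := chart_map c p.
have : nbhs a (img c).
  by apply: open_nbhs_nbhs; split; [exact: chart_img_open|exists p].
move=> /nbhs_ballP[e /= e0 ae]; pose r := e / 2.
have r0 : 0 < r by rewrite divr_gt0.
exists [set u | forall i, `[a 0 i - r, a 0 i + r]%classic (u 0 i)].
exists (flat 0 \o (fun u => r ^+ 2 - \sum_i (u 0 i - a 0 i) ^+ 2)); split.
- by apply: (@rV_compact R m (fun i => `[a 0 i - r, a 0 i + r]%classic)) => i;
  exact: segment_compact.
- move=> u au; apply: ae; rewrite -ball_normE /=.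
  rewrite [X in X < _]/Num.Def.normr /= mx_normrE; apply: bigmax_lt => // -[i j] _ /=.
  rewrite !mxE ord1; have := au j; rewrite /= in_itv /= => H.
  rewrite ltr_norml; move: r0 H; rewrite /r => ? /andP[? ?]; lra.
- move=> U oU k; apply: Ck_flat => // {}k.
  have H : Ck k U (cst (r ^+ 2) + cst (-1) * (fun u : 'rV_m => \sum_i ((fun u :
    'rV_m => u 0 i) + cst (- a 0 i)) u * ((fun u : 'rV_m => u 0 i) + cst (- a 0 i)) u)).
    have C (b : R) : Ck k U (cst b) by exact: Ck_cst.
    apply: CkD => //; apply: CkM => //; apply: Ck_sum => // i.
    by apply: CkM => //; apply: CkD => //; exact: Ck_projection.
  apply: (eq_Ck oU _ H) => u _.
  by rewrite !fctE /= mulN1r.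
- move=> u /existsNP[i Hi]; rewrite /= flat_le0 // subr_le0.
  rewrite (bigD1 i) //=; apply: ler_wpDr; first by apply: sumr_ge0 => ? _; exact:
    sqr_ge0.
  rewrite leNgt; apply/negP => H; apply: Hi.
  rewrite /= in_itv /=; have := H; rewrite -subr_gt0 => H1.
  apply/andP; split; nra.
- rewrite /= flat0_gt0 // big1 ?subr0 ?exprn_gt0 // => i _.
  by rewrite subrr expr0n.
Qed.

(** Cut off coordinate derivatives, paired with cut off coordinates centred at [p]. The centred
    coordinates vanish at [p], so the derivative of the cutoff drops out and [k] is the square of
    the cutoff at [p]. *)
Lemma exists_dual_fields (p : M) : exists (X : 'I_m -> 'Vect(M)) (f : 'I_m ->
  'C^oo(M)) (k : R),
  k != 0 /\ forall i j, X i (f j) p = k *+ (i == j).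
Proof.
have [c Ac cp] := atlas_cover p.
have [K [psi [cK Kc spsi psi0 psip]]] := exists_bump cp.
set a := chart_map c p in psip.
have oi : open (img c) by exact: chart_img_open.
pose h (j : 'I_m) (u : 'rV[R]_m) := psi u * (u 0 j - a 0 j).
have sh j : smooth_on (img c) (h j).
  move=> k; have H : Ck k (img c) (psi * ((fun u : 'rV_m => u 0 j) + cst (- a 0 j))).
    apply: CkM => //; first exact: spsi.
    by apply: CkD => //; [exact: Ck_projection|exact: Ck_cst].
  exact: (eq_Ck oi _ H).
have h0 j u : ~ K u -> h j u = 0 by move=> Ku; rewrite /h psi0 // mul0r.
exists (fun i => coord_field Ac cK Kc (spsi _ oi) psi0 (delta_mx 0 i)).
exists (fun j => smooth_fun_of (smooth_extend Ac cK Kc (sh j) (h0 j))).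
exists (psi a ^+ 2); split; first by rewrite expf_neq0 // gt_eqF.
move=> i j; rewrite coord_fieldE // -/a.
have ia : img c a by exists p.
have -> : 'D_(delta_mx 0 i) (smooth_fun_of (smooth_extend Ac cK Kc (sh j) (h0 j))
  \o chart_inv c) a
   = 'D_(delta_mx 0 i) (psi * ((fun u : 'rV_m => u 0 j) + cst (- a 0 j))) a.
  apply: near_eq_derive; apply: filterS (open_nbhs_nbhs (conj oi ia)).
  by move=> _ [q cq <-] /=; rewrite chart_mapK // extendE.
have dp : derivable psi a (delta_mx 0 i) by apply: smooth_onP ia; exact: spsi.
have dc : derivable (fun u : 'rV[R]_m => u 0 j) a (delta_mx 0 i).
  exact/diff_derivable/differentiable_coord.
have dk : derivable (cst (- a 0 j) : 'rV[R]_m -> R) a (delta_mx 0 i).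
  by apply: diff_derivable; exact: differentiable_cst.
rewrite (deriveM dp (derivableD dc dk)) (deriveD dc dk).
rewrite derive_cst addr0 !fctE /= subrr scale0r addr0.
have := derive_mx (@derivable_id R 'rV[R]_m a (delta_mx 0 i)).
rewrite derive_id => /matrixP/(_ 0 j); rewrite !mxE eqxx /= => <-.
rewrite [_ *: _]/(_ * _) mulrA -expr2 mulr_natr eq_sym; by [].
Qed.

End ChartExtension.

(** * Orthogonal frames and traces *)

Section VectorFieldTheory.
Context {R : realType} {m : nat} {M : manifold R m}.
Implicit Types (X Y Z : 'Vect(M)) (f h : 'C^oo(M)) (p q : M).

Lemma vfieldD X Y f : (X + Y) f = X f + Y f. Proof. by []. Qed.
Lemma vfieldZ h X f : (h *: X) f = h * X f. Proof. by []. Qed.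
Lemma vfield0 f : (0 : 'Vect(M)) f = 0. Proof. by []. Qed.
Lemma vfieldN X f : (- X) f = - X f. Proof. exact: mulN1r. Qed.
Lemma vfieldB X Y f : (X - Y) f = X f - Y f. Proof. by rewrite vfieldD vfieldN. Qed.

Lemma vfield_sum (I : Type) (r : seq I) (F : I -> 'Vect(M)) f :
  (\sum_(i <- r) F i) f = \sum_(i <- r) F i f.
Proof. by elim/big_rec2: _ => // i X h _ <-. Qed.

Lemma derivationD X f h : X (f + h) = X f + X h.
Proof. by have := vfield_linear X 1 f h; rewrite !scale1r. Qed.
Lemma derivation0 X : X 0 = 0.
Proof. by apply: (addrI (X 0)); rewrite -derivationD !addr0. Qed.
Lemma derivationZ X a f : X (a *: f) = a *: X f.
Proof. by have := vfield_linear X a f 0; rewrite derivation0 !addr0. Qed.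
Lemma derivationN X f : X (- f) = - X f.
Proof. by rewrite -scaleN1r derivationZ scaleN1r. Qed.
Lemma derivationB X f h : X (f - h) = X f - X h.
Proof. by rewrite derivationD derivationN. Qed.
Lemma derivationM X f h : X (f * h) = X f * h + f * X h.
Proof. exact: vfield_leibniz. Qed.
Lemma derivation1 X : X 1 = 0.
Proof.
have := derivationM X 1 1; rewrite !mulr1 mul1r => H.
by apply: (addrI (X 1)); rewrite addr0 -H.
Qed.
Lemma derivation_sum X (I : Type) (r : seq I) (F : I -> 'C^oo(M)) :
  X (\sum_(i <- r) F i) = \sum_(i <- r) X (F i).
Proof.
elim: r => [|i r IH]; first by rewrite !big_nil derivation0.
by rewrite !big_cons derivationD IH.
Qed.
Lemma derivationMn X f k : X (f *+ k) = X f *+ k.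
Proof. by elim: k => [|k IH]; rewrite ?derivation0 // !mulrS derivationD IH. Qed.

Lemma smooth_sum (I : Type) (r : seq I) (F : I -> 'C^oo(M)) q :
  (\sum_(i <- r) F i) q = \sum_(i <- r) F i q.
Proof. by elim/big_rec2: _ => // i a h _ <-. Qed.
Lemma smooth_prod (I : Type) (r : seq I) (P : pred I) (F : I -> 'C^oo(M)) q :
  (\prod_(i <- r | P i) F i) q = \prod_(i <- r | P i) F i q.
Proof. by elim/big_rec2: _ => // i a h _ <-. Qed.

Definition cstf (a : R) : 'C^oo(M) := a *: (1 : 'C^oo(M)).
Lemma cstfE a q : cstf a q = a. Proof. exact: mulr1. Qed.
Lemma cstf1 : cstf 1 = 1. Proof. exact: scale1r. Qed.
Lemma vfield_cst X a : X (cstf a) = 0.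
Proof. by rewrite derivationZ derivation1 scaler0. Qed.

End VectorFieldTheory.

Section Metric.
Context {R : realType} {d : nat} {M : manifold R d.+1}.
Variables (g : 'Vect(M) -> 'Vect(M) -> 'C^oo(M)) (rm : riemannian_metric g).
Implicit Types (X Y Z : 'Vect(M)) (f h : 'C^oo(M)) (p q : M).

Lemma metricC X Y : g X Y = g Y X. Proof. exact: (Defs.metric_sym rm). Qed.
Lemma metricDl X Y Z : g (X + Y) Z = g X Z + g Y Z.
Proof. by have := metric_linear rm Z 1 X Y; rewrite scale1r mul1r. Qed.
Lemma metric0l Z : g 0 Z = 0.
Proof. by apply: (addrI (g 0 Z)); rewrite -metricDl !addr0. Qed.
Lemma metricZl h X Z : g (h *: X) Z = h * g X Z.
Proof. by have := metric_linear rm Z h X 0; rewrite metric0l !addr0. Qed.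
Lemma metricNl X Z : g (- X) Z = - g X Z.
Proof. by rewrite -scaleN1r metricZl mulN1r. Qed.
Lemma metricBl X Y Z : g (X - Y) Z = g X Z - g Y Z.
Proof. by rewrite metricDl metricNl. Qed.
Lemma metricDr X Y Z : g Z (X + Y) = g Z X + g Z Y.
Proof. by rewrite ![g Z _]metricC metricDl. Qed.
Lemma metricZr h X Z : g Z (h *: X) = h * g Z X.
Proof. by rewrite ![g Z _]metricC metricZl. Qed.
Lemma metricNr X Z : g Z (- X) = - g Z X.
Proof. by rewrite ![g Z _]metricC metricNl. Qed.
Lemma metricBr X Y Z : g Z (X - Y) = g Z X - g Z Y.
Proof. by rewrite metricDr metricNr. Qed.
Lemma metric_suml (I : Type) (r : seq I) (F : I -> 'Vect(M)) Z :
  g (\sum_(i <- r) F i) Z = \sum_(i <- r) g (F i) Z.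
Proof.
elim: r => [|i r IH]; first by rewrite !big_nil metric0l.
by rewrite !big_cons metricDl IH.
Qed.
Lemma metric_sumr (I : Type) (r : seq I) (F : I -> 'Vect(M)) Z :
  g Z (\sum_(i <- r) F i) = \sum_(i <- r) g Z (F i).
Proof. by rewrite metricC metric_suml; apply: eq_bigr => i _; rewrite metricC. Qed.

Lemma null_vfield p X f : g X X p = 0 -> X f p = 0.
Proof.
move=> gX; apply/eqP/negPn/negP => Xf.
by have := metric_pos rm (ex_intro _ f Xf); rewrite gX ltxx.
Qed.

(* A field that vanishes at [p] as a derivation is not known at this stage to be
   null for [g] at [p]; it is perturbed into a field that does not vanish. *)
Lemma metric_ge0 p X : 0 <= g X X p.
Proof.
have [Y [f [k [k0 Yf]]]] := exists_dual_fields p.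
case: (boolP `[< exists f, X f p != 0 >]) => [/asboolP H|/asboolPn H].
  by apply/ltW/(metric_pos rm).
have Xf h : X h p = 0 by apply/eqP/negPn/negP => Xh; apply: H; exists h.
have pos t : t != 0 -> 0 < g X X p + t * g X (Y ord0) p *+ 2 + t ^+ 2 * g (Y ord0)
  (Y ord0) p.
  move=> t0; have : exists f, (X + cstf t *: Y ord0) f p != 0.
    exists (f ord0); rewrite vfieldD vfieldZ smoothD smoothM cstfE Xf add0r Yf.
    by rewrite eqxx mulf_neq0.
  move=> /(metric_pos rm); rewrite metricDl !metricDr !metricZl !metricZr.
  rewrite !(smoothD, smoothM, cstfE) (metricC (Y ord0) X).
  congr (0 < _); ring.
have dpos : 0 < g (Y ord0) (Y ord0) p.
  by apply: (metric_pos rm); exists (f ord0); rewrite Yf eqxx.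
set c := g X X p in pos *; set b := g X _ p in pos; set e := g _ _ p in pos dpos.
rewrite leNgt; apply/negP => c0.
(* For t = s and t = -s the outer terms of [pos] cancel and 2tb remains, which is nonpositive for
   one of the two signs. *)
have s0 : 0 < Num.sqrt (- c / e) by rewrite sqrtr_gt0 divr_gt0 // oppr_gt0.
have s2 : Num.sqrt (- c / e) ^+ 2 * e = - c.
  by rewrite sqr_sqrtr ?divfK ?gt_eqF // ltW // divr_gt0 // oppr_gt0.
set s := Num.sqrt _ in s0 s2.
have := pos s (lt0r_neq0 s0); have := pos (- s).
rewrite oppr_eq0 => /(_ (lt0r_neq0 s0)); rewrite sqrrN s2.
case: (leP 0 b) => b0; nra.
Qed.

(** A Cauchy-Schwarz argument: for t = -b/(e+1) the squared length of X + tY is -b^2 (e+2)/(e+1)^2,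
    which forces b = 0. The denominator e+1 also covers e = 0. *)
Lemma null_metric p X Y : g X X p = 0 -> g X Y p = 0.
Proof.
move=> X0; set b := g X Y p; set e := g Y Y p.
have e0 : 0 <= e by exact: metric_ge0.
have := metric_ge0 p (X + cstf (- b / (e + 1)) *: Y).
rewrite metricDl !metricDr !metricZl !metricZr.
rewrite !(smoothD, smoothM, cstfE) (metricC Y X) X0 -/b -/e add0r.
have -> : - b / (e + 1) * b + (- b / (e + 1) * b + - b / (e + 1) * (- b / (e + 1) * e))
   = - (b ^+ 2 * ((e + 2) / (e + 1) ^+ 2)).
  by field; lra.
rewrite oppr_ge0 => H; apply/eqP; rewrite -sqrf_eq0 eq_le sqr_ge0 andbT.
move: H; rewrite pmulr_lle0 // divr_gt0 ?exprn_gt0 //; lra.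
Qed.

Lemma null_eq0 X : (forall p, g X X p = 0) -> X = 0.
Proof.
move=> X0; apply: vfieldP => f; apply: smooth_funE => p.
by rewrite null_vfield.
Qed.

Lemma g_nondegenerate X Y : (forall Z, g X Z = g Y Z) -> X = Y.
Proof.
move=> H; apply/eqP; rewrite -subr_eq0; apply/eqP/null_eq0 => p.
by rewrite metricBl H subrr.
Qed.

End Metric.

Section Frames.
Context {R : realType} {d : nat} {M : manifold R d.+1}.
Variables (g : 'Vect(M) -> 'Vect(M) -> 'C^oo(M)) (rm : riemannian_metric g).
Variables (xi : 'Vect(M)) (xi1 : g xi xi = 1).
Implicit Types (X Y Z : 'Vect(M)) (f h : 'C^oo(M)) (p q : M).

(** Orthogonality is asked on the whole manifold so that it can be differentiated; the squared norms
    stay free and may vanish away from the point of interest. *)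
Definition orthogonal_fields k (e : 'I_k -> 'Vect(M)) :=
  forall i j, i != j -> g (e i) (e j) = 0.

Definition sqnorms k (e : 'I_k -> 'Vect(M)) : 'C^oo(M) :=
  \prod_i g (e i) (e i).
Definition sqnorms' k (e : 'I_k -> 'Vect(M)) i : 'C^oo(M) :=
  \prod_(j | j != i) g (e j) (e j).

Lemma sqnormsE k (e : 'I_k -> 'Vect(M)) i :
  sqnorms e = g (e i) (e i) * sqnorms' e i.
Proof. by rewrite /sqnorms (bigD1 i). Qed.

(* Division-free Gram-Schmidt: the orthogonal projection of [Z] away from the
   [e i], multiplied by the product of the squared norms of the [e i]. *)
Definition reduce k (e : 'I_k -> 'Vect(M)) Z : 'Vect(M) :=
  sqnorms e *: Z - \sum_i (sqnorms' e i * g Z (e i)) *: e i.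

Lemma g_reduce k (e : 'I_k -> 'Vect(M)) Z Y :
  g (reduce e Z) Y = sqnorms e * g Z Y - \sum_i sqnorms' e i * g Z (e i) * g (e i) Y.
Proof.
rewrite /reduce (metricBl rm) (metricZl rm) (metric_suml rm); congr (_ - _).
by apply: eq_bigr => i _; rewrite (metricZl rm).
Qed.

Lemma reduce_orthogonal k (e : 'I_k -> 'Vect(M)) Z j : orthogonal_fields e ->
  g (reduce e Z) (e j) = 0.
Proof.
move=> oe; rewrite g_reduce (bigD1 j) //= big1 => [|i ij]; last by rewrite oe // mulr0.
by rewrite (sqnormsE _ j); ring.
Qed.

Definition trace_of (A : 'Vect(M) -> 'Vect(M)) (tau : 'C^oo(M)) := forall p e,
  orthonormal_at g p e -> tau p = \sum_i g (A (e i)) (e i) p.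

Variable tau0 : 'C^oo(M).
Hypothesis tau0P : trace_of (fun X => g X xi *: xi - X) tau0.

(* The trace of [X |-> g X xi *: xi - X] is minus the number of frame fields
   other than [xi], so that a frame containing [xi] has no room for another
   orthonormal field: swapping it with [xi] would change the trace. *)
Lemma rank_bound p e Z : e ord0 = xi -> orthonormal_at g p e ->
  (forall i, g Z (e i) p = 0) -> g Z Z p = 0.
Proof.
move=> e0 oe Ze; apply/eqP/negPn/negP => Z0.
have Zpos : 0 < g Z Z p by rewrite lt0r Z0 (metric_ge0 rm).
pose c := (Num.sqrt (g Z Z p))^-1.
have c2 : c * (c * g Z Z p) = 1.
  rewrite mulrA -expr2 exprVn sqr_sqrtr ?ltW // mulVf //.
pose e' i := if i == ord0 then cstf c *: Z else e i.
have oe' : orthonormal_at g p e'.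
  move=> i j; rewrite /e'; have [->|i0] := eqVneq i ord0; have [jE|j0] := eqVneq j ord0.
  - by rewrite (metricZl rm) (metricZr rm) !smoothM cstfE c2.
  - by rewrite (metricZl rm) smoothM Ze mulr0.
  - by rewrite jE (metricZr rm) (metricC rm) smoothM Ze mulr0 (negbTE i0).
  - exact: oe.
have := tau0P oe; rewrite (tau0P oe') !big_ord_recl /e' eqxx /=.
move=> /addIr; rewrite e0 xi1 scale1r subrr (metric0l rm) smooth0.
have Zxi : g Z xi p = 0 by rewrite -e0 Ze.
rewrite (metricBl rm) !(metricZl rm) !(metricZr rm) (metricC rm xi) smoothD smoothN
  !smoothM Zxi.
by rewrite cstfE c2; lra.
Qed.

Lemma normalize_orthonormal p (e : 'I_d.+1 -> 'Vect(M)) : orthogonal_fields e ->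
  (forall i, g (e i) (e i) p != 0) ->
  orthonormal_at g p (fun i => cstf (Num.sqrt (g (e i) (e i) p))^-1 *: e i).
Proof.
move=> oe e0 i j; rewrite (metricZl rm) (metricZr rm) !smoothM !cstfE.
case: (eqVneq i j) => [<-|ij]; last by rewrite (oe _ _ ij) smooth0 !mulr0.
rewrite mulrA -expr2 exprVn sqr_sqrtr ?mulVf //; exact: metric_ge0.
Qed.

(** Where no [e i] is null, [rank_bound] applies to the normalized frame. Elsewhere [sqnorms e]
    vanishes, and it divides the squared norm of the reduced field. *)
Lemma reduce_eq0 (e : 'I_d.+1 -> 'Vect(M)) Z : orthogonal_fields e -> e ord0 = xi
  -> reduce e Z = 0.
Proof.
move=> oe e0; apply: (null_eq0 rm) => p; set W := reduce e Z.
have WE : g W W = sqnorms e * g W Z.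
  rewrite {2}/W /reduce (metricBr rm) (metricZr rm) (metric_sumr rm) big1 ?subr0 //
    => i _.
  by rewrite (metricZr rm) reduce_orthogonal // mulr0.
case: (boolP [forall i, g (e i) (e i) p != 0]) => [/forallP e_n0|].
  apply: (rank_bound _ (normalize_orthonormal oe e_n0)) => [|i].
    by rewrite e0 xi1 smooth1 sqrtr1 invr1 cstf1 scale1r.
  by rewrite (metricZr rm) reduce_orthogonal // mulr0.
rewrite negb_forall => /existsP[i /negPn/eqP ei].
by rewrite WE (sqnormsE _ i) !smoothM ei !mul0r.
Qed.

(** The trace formula with denominators cleared, valid also where the frame degenerates and
    therefore open to differentiation. At a point where [e i] is null, the one summand without the
    factor [g (e i) (e i)] vanishes by [null_metric]. *)
Lemma trace_global A tau (e : 'I_d.+1 -> 'Vect(M)) : (forall h X, A (h *: X) = h *: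
  A X) ->
  trace_of A tau -> orthogonal_fields e ->
  sqnorms e * tau = \sum_i sqnorms' e i * g (A (e i)) (e i).
Proof.
move=> AZ tauP oe; apply: smooth_funE => p; rewrite smoothM smooth_sum.
case: (boolP [forall i, g (e i) (e i) p != 0]) => [/forallP e_n0|].
  rewrite (tauP _ _ (normalize_orthonormal oe e_n0)) mulr_sumr.
  apply: eq_bigr => i _; rewrite AZ (metricZl rm) (metricZr rm) (sqnormsE _ i)
    !smoothM !cstfE.
  set N := g (e i) (e i) p; set c := _^-1.
  have c2 : N * c ^+ 2 = 1.
    rewrite /c exprVn sqr_sqrtr ?mulfV //; first exact: e_n0.
    exact: metric_ge0.
  transitivity ((N * c ^+ 2) * (sqnorms' e i p * g (A (e i)) (e i) p)); first ring.
  by rewrite c2 mul1r.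
rewrite negb_forall => /existsP[i /negPn/eqP ei].
rewrite (sqnormsE _ i) smoothM ei !mul0r big1 // => j _; rewrite smoothM.
have [->|ij] := eqVneq j i; first by rewrite (metricC rm) (null_metric rm) // mulr0.
have -> : sqnorms' e j = g (e i) (e i) * \prod_(l | (l != j) && (l != i)) g (e l) (e l).
  by rewrite /sqnorms' (bigD1 i) // eq_sym.
by rewrite smoothM ei !mul0r.
Qed.

(** If all reductions of the [X i] were null at [p], a nonzero row [v] in the kernel of the matrix
    of the g (X i) (e j) would give a combination of the [X i] null at [p]; the dual functions [f j]
    show that its coefficients vanish. *)
Lemma extend_frame p k (e : 'I_k -> 'Vect(M)) : (k < d.+1)%N ->
  orthogonal_fields e -> (forall i, g (e i) (e i) p = 1) ->
  exists Z, g Z Z p = 1 /\ forall i, g Z (e i) = 0.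
Proof.
move=> kd oe e1.
have N1 : sqnorms e p = 1 by rewrite smooth_prod big1.
have N'1 i : sqnorms' e i p = 1 by rewrite smooth_prod big1.
have [X [f [c [c0 Xf]]]] := exists_dual_fields p.
have [i Xi] : exists i, g (reduce e (X i)) (reduce e (X i)) p != 0.
  apply/not_existsP => H.
  have H0 i : g (reduce e (X i)) (reduce e (X i)) p = 0.
    by apply/eqP/negPn/negP/H.
  pose A := \matrix_(i < d.+1, j < k) g (X i) (e j) p.
  have : kermx A != 0.
    rewrite kermx_eq0 /row_free; apply/negP => /eqP rA.
    by have := rank_leq_col A; rewrite rA leqNgt kd.
  move=> /rowV0Pn[v /sub_kermxP vA v0].
  pose Y := \sum_i cstf (v 0 i) *: X i.
  have Ye j : g Y (e j) p = 0.
    rewrite (metric_suml rm) smooth_sum; have /rowP/(_ j) := vA; rewrite !mxE => {2}<-.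
    by apply: eq_bigr => i _; rewrite (metricZl rm) smoothM cstfE mxE.
  have YZ Z : g Y Z p = 0.
    rewrite (metric_suml rm) smooth_sum.
    have E i : g (X i) Z p = \sum_j g (X i) (e j) p * g (e j) Z p.
      have := null_metric rm Z (H0 i).
      rewrite g_reduce smoothD smoothN smoothM N1 mul1r smooth_sum => /eqP.
      rewrite subr_eq0 => /eqP ->; apply: eq_bigr => j _.
      by rewrite !smoothM N'1 mul1r.
    under eq_bigr => i _ do rewrite (metricZl rm) smoothM cstfE E mulr_sumr.
    rewrite exchange_big /= big1 // => j _.
    under eq_bigr => i _ do rewrite mulrA.
    rewrite -mulr_suml [X in X * _](_ : _ = g Y (e j) p) ?Ye ?mul0r //.
    rewrite -[RHS](Ye j) (metric_suml rm) smooth_sum; apply: eq_bigr => l _.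
    by rewrite (metricZl rm) smoothM cstfE.
  move/eqP: v0; apply; apply/rowP => j; rewrite mxE.
  have := null_vfield rm (f j) (YZ Y); rewrite vfield_sum smooth_sum (bigD1 j) //
    big1 => [|i ij].
    by rewrite Monoid.mulm1 vfieldZ smoothM cstfE Xf eqxx => /eqP; rewrite mulf_eq0
      (negbTE c0) orbF => /eqP.
  by rewrite vfieldZ smoothM Xf (negbTE ij) mulr0.
set W := reduce e (X i) in Xi.
exists (cstf (Num.sqrt (g W W p))^-1 *: W); split.
  rewrite (metricZl rm) (metricZr rm) !smoothM cstfE mulrA -expr2 exprVn sqr_sqrtr
    ?mulVf //.
  exact: metric_ge0.
by move=> j; rewrite (metricZl rm) reduce_orthogonal // mulr0.
Qed.

Lemma exists_orthogonal_frame p : exists e : 'I_d.+1 -> 'Vect(M),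
  [/\ orthogonal_fields e, e ord0 = xi & forall i, g (e i) (e i) p = 1].
Proof.
suff H k : (k <= d)%N -> exists e : 'I_k.+1 -> 'Vect(M),
  [/\ orthogonal_fields e, e ord0 = xi & forall i, g (e i) (e i) p = 1] by exact: H.
elim: k => [_|k IH kd].
  exists (fun _ => xi); split=> // [i j|i]; first by rewrite !ord1.
  by rewrite xi1.
have [e [oe e0 e1]] := IH (ltnW kd).
have [Z [Z1 Ze]] := extend_frame (k := k.+1) kd oe e1.
exists (fun i => oapp e Z (unlift ord_max i)); split.
- move=> i j; case: unliftP => [i'|] ->; case: unliftP => [j'|] -> //=.
  + by rewrite (inj_eq lift_inj); exact: oe.
  + by rewrite (metricC rm).
  + by rewrite eqxx.
- by have -> : ord0 = lift ord_max ord0 :> 'I_k.+2; [exact: val_inj|rewrite liftK].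
- by move=> i; case: unliftP => [i'|] _ /=.
Qed.

(* Rescaling by [(3 - N) / 2], where [N] is the squared norm, which has value 1
   at [p], turns [N] into [N * ((3 - N) / 2)^2], stationary at [p]. *)
Lemma exists_stationary_frame p : exists e : 'I_d.+1 -> 'Vect(M),
  [/\ orthogonal_fields e, e ord0 = xi, (forall i, g (e i) (e i) p = 1) &
      forall i X, X (g (e i) (e i)) p = 0].
Proof.
have [e [oe e0 e1]] := exists_orthogonal_frame p.
have [r [r1 r0 Xr]] : exists r : 'I_d.+1 -> 'C^oo(M), [/\ forall i, r i p = 1,
    r ord0 = 1 & forall i X, X (r i) = - (cstf 2^-1 * X (g (e i) (e i)))].
  exists (fun i => cstf 2^-1 * (cstf 3 - g (e i) (e i))); split.
  - by move=> i; rewrite smoothM smoothD smoothN !cstfE e1; lra.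
  - apply: smooth_funE => q; rewrite smoothM smoothD smoothN !cstfE e0 xi1 smooth1; lra.
  - by move=> i X; rewrite derivationM vfield_cst mul0r add0r derivationB
    vfield_cst sub0r mulrN.
exists (fun i => r i *: e i); split.
- by move=> i j ij; rewrite (metricZl rm) (metricZr rm) (oe _ _ ij) !mulr0.
- by rewrite e0 r0 scale1r.
- by move=> i; rewrite (metricZl rm) (metricZr rm) !smoothM r1 e1 !mul1r.
- move=> i X; rewrite (metricZl rm) (metricZr rm) !derivationM Xr !(smoothD,
  smoothM, smoothN) r1 e1.
  by rewrite cstfE; lra.
Qed.

End Frames.

(** * Covariant derivatives of traces *)

Section TraceDerivative.
Context {R : realType} {d : nat} {M : manifold R d.+1}.
Variables (g : 'Vect(M) -> 'Vect(M) -> 'C^oo(M)) (rm : riemannian_metric g).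
Variables (xi : 'Vect(M)) (xi1 : g xi xi = 1).
Implicit Types (X Y Z : 'Vect(M)) (f h : 'C^oo(M)) (p q : M).
Variable tau0 : 'C^oo(M).
Hypothesis tau0P : trace_of g (fun X => g X xi *: xi - X) tau0.

Lemma scalar_sum (L : 'Vect(M) -> 'C^oo(M)) (I : Type) (r : seq I)
    (c : I -> 'C^oo(M)) (F : I -> 'Vect(M)) : scalar L ->
  L (\sum_(i <- r) c i *: F i) = \sum_(i <- r) c i * L (F i).
Proof.
move=> Ll; elim: r => [|i r IH].
  rewrite !big_nil; have := Ll 1 0 0; rewrite scale1r mul1r addr0 => H.
  by apply: (addrI (L 0)); rewrite addr0 -H.
by rewrite !big_cons Ll IH.
Qed.

(** [L] acts on fields rather than on tangent vectors, so it is applied to the global identity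
    [reduce_eq0], and only then is everything evaluated at [p], where the norms are 1. *)
Lemma frame_expansion p (e : 'I_d.+1 -> 'Vect(M)) L Z : orthogonal_fields g e ->
  e ord0 = xi -> (forall i, g (e i) (e i) p = 1) -> scalar L ->
  L Z p = \sum_i g Z (e i) p * L (e i) p.
Proof.
move=> oe e0 e1 Ll.
have L0 : L 0 = 0.
  have := scalar_sum [::] (fun _ : nat => 1) (fun _ => 0) Ll.
  by rewrite !big_nil.
have := reduce_eq0 rm xi1 tau0P Z oe e0; rewrite /reduce => /(congr1 L).
rewrite L0 addrC -sumrN.
under eq_bigr => i _ do rewrite -scaleNr.
rewrite addrC -[X in L (_ + X)]addr0 Ll.
have -> : \sum_i - (sqnorms' g e i * g Z (e i)) *: e i + 0 =
  \sum_i (- (sqnorms' g e i * g Z (e i))) *: e i by rewrite addr0.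
rewrite scalar_sum // => /(congr1 (fun h : 'C^oo(M) => h p)).
rewrite smoothD smoothM smooth_sum {1}/sqnorms smooth_prod big1 // mul1r smooth0.
move=> /eqP; rewrite addr_eq0 => /eqP ->; rewrite -sumrN; apply: eq_bigr => i _.
rewrite !(smoothM, smoothN) /sqnorms' smooth_prod big1 // mul1r; ring.
Qed.

Section Connection.
Variables (nabla : 'Vect(M) -> 'Vect(M) -> 'Vect(M)) (lc : levi_civita g nabla).

(** The trace commutes with the covariant derivative. Differentiating [trace_global] in a frame with
    stationary norms leaves, besides the claim, connection coefficients paired with the symmetric
    part of [A]. *)
Lemma trace_derivative p X : exists e : 'I_d.+1 -> 'Vect(M),
  [/\ orthogonal_fields g e, e ord0 = xi, (forall i, g (e i) (e i) p = 1) &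
   forall A tau, linear A -> trace_of g A tau ->
    X tau p = \sum_i g (nabla X (A (e i)) - A (nabla X (e i))) (e i) p].
Proof.
have [e [oe e0 e1 de]] := exists_stationary_frame rm xi1 p.
exists e; split=> // A tau Al tauA.
have AZ h Y : A (h *: Y) = h *: A Y.
  have A0 : A 0 = 0.
    have := Al 1 0 0; rewrite !scale1r !addr0 => H.
    by apply: (addrI (A 0)); rewrite addr0 -H.
  by have := Al h Y 0; rewrite A0 !addr0.
have dprod (P : pred 'I_d.+1) : (\prod_(i | P i) g (e i) (e i)) p = 1 /\
    X (\prod_(i | P i) g (e i) (e i)) p = 0.
  elim/big_ind: _ => [|h f [h1 h0] [f1 f0]|i _].
  - by rewrite derivation1.
  - by rewrite derivationM smoothD !smoothM h1 h0 f1 f0 mulr0 mul0r addr0 mulr1.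
  - by rewrite e1 de.
have := trace_global rm AZ tauA oe => /(congr1 (fun h => X h p)) /=.
have [N1 N0] := dprod xpredT.
rewrite derivationM derivation_sum smoothD !smoothM smooth_sum {1 2}/sqnorms N1 N0
  mul0r add0r mul1r => ->.
have -> : \sum_i X (sqnorms' g e i * g (A (e i)) (e i)) p =
   \sum_i X (g (A (e i)) (e i)) p.
  apply: eq_bigr => i _; have [N'1 N'0] := dprod (predC1 i).
  by rewrite derivationM smoothD !smoothM /sqnorms' N'1 N'0 mul0r add0r mul1r.
apply/eqP; rewrite -subr_eq0 -sumrB; apply/eqP.
have Ex i : X (g (A (e i)) (e i)) p - g (nabla X (A (e i)) - A (nabla X (e i))) (e i) p
   = \sum_j g (nabla X (e i)) (e j) p * (g (A (e i)) (e j) p + g (A (e j)) (e i) p).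
  rewrite (lc_metric lc) (metricBl rm) !(smoothD, smoothN).
  have E1 := frame_expansion (L := g (A (e i))) (nabla X (e i)) oe e0 e1.
  have E2 := frame_expansion (L := fun Z => g (A Z) (e i)) (nabla X (e i)) oe e0 e1.
  rewrite E1; last by move=> h Y Z; rewrite (metricDr rm) (metricZr rm).
  rewrite E2; last by move=> h Y Z; rewrite Al (metricDl rm) (metricZl rm).
  under [RHS]eq_bigr => j _ do rewrite mulrDr.
  rewrite big_split /=; ring.
under eq_bigr => i _ do rewrite Ex.
(* The coefficients g (nabla X (e i)) (e j) are skew in i and j at [p], the other factor is
   symmetric, so exchanging the indices changes the sign. *)
set T := \sum_i _; suff TN : T = - T by lra.
rewrite {1}/T exchange_big /= -sumrN; apply: eq_bigr => i _.
rewrite -sumrN; apply: eq_bigr => j _.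
have : g (nabla X (e i)) (e j) p + g (nabla X (e j)) (e i) p = 0.
  have := lc_metric lc (e i) (e j) X => /(congr1 (fun h : 'C^oo(M) => h p)).
  rewrite smoothD [g (e i) (nabla _ _)](metricC rm) => <-.
  by have [->|ij] := eqVneq i j; [exact: de|rewrite oe // derivation0].
move=> /eqP; rewrite addr_eq0 => /eqP ->; ring.
Qed.

End Connection.
End TraceDerivative.

(** * Lie derivatives of the connection and of Hessians *)

Section Connection.
Context {R : realType} {d : nat} {M : manifold R d.+1}.
Variables (g : 'Vect(M) -> 'Vect(M) -> 'C^oo(M)) (rm : riemannian_metric g).
Variables (nabla : 'Vect(M) -> 'Vect(M) -> 'Vect(M)) (lc : levi_civita g nabla).
Implicit Types (X Y Z U W : 'Vect(M)) (f h u : 'C^oo(M)) (p q : M).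

Lemma nablaDl X Y Z : nabla (X + Y) Z = nabla X Z + nabla Y Z.
Proof. by have := connection_linear (lc_connection lc) Z 1 X Y; rewrite !scale1r. Qed.
Lemma nabla0l Z : nabla 0 Z = 0.
Proof. by apply: (addrI (nabla 0 Z)); rewrite -nablaDl !addr0. Qed.
Lemma nablaZl h X Z : nabla (h *: X) Z = h *: nabla X Z.
Proof. by have := connection_linear (lc_connection lc) Z h X 0; rewrite nabla0l
  !addr0. Qed.
Lemma nablaNl X Z : nabla (- X) Z = - nabla X Z.
Proof. by rewrite -scaleN1r nablaZl scaleN1r. Qed.
Lemma nablaBl X Y Z : nabla (X - Y) Z = nabla X Z - nabla Y Z.
Proof. by rewrite nablaDl nablaNl. Qed.
Lemma nablaDr X Y Z : nabla Z (X + Y) = nabla Z X + nabla Z Y.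
Proof. exact: connection_add (lc_connection lc) _ _ _. Qed.
Lemma nablaZr h X Z : nabla Z (h *: X) = Z h *: X + h *: nabla Z X.
Proof. exact: connection_leibniz (lc_connection lc) _ _ _. Qed.
Lemma nablaNr X Z : nabla Z (- X) = - nabla Z X.
Proof. by rewrite -scaleN1r nablaZr derivationN derivation1 oppr0 scale0r add0r
  scaleN1r. Qed.
Lemma nablaBr X Y Z : nabla Z (X - Y) = nabla Z X - nabla Z Y.
Proof. by rewrite nablaDr nablaNr. Qed.

Lemma bracketE X Y : bracket X Y = nabla X Y - nabla Y X.
Proof. by rewrite (lc_torsion_free lc). Qed.

Lemma bracket_f X Y f : bracket X Y f = X (Y f) - Y (X f).
Proof. by []. Qed.

Lemma bracketBr W X Y : bracket W (X - Y) = bracket W X - bracket W Y.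
Proof.
apply: vfieldP => f; rewrite !(bracket_f, vfieldB, derivationB); ring.
Qed.

Lemma jacobi W X Y :
  bracket W (bracket X Y) = bracket (bracket W X) Y + bracket X (bracket W Y).
Proof.
apply: vfieldP => f; rewrite !(vfieldD, bracket_f, derivationB); ring.
Qed.

Lemma bracketZl h X Y : bracket (h *: X) Y = h *: bracket X Y - Y h *: X.
Proof.
apply: vfieldP => f; rewrite vfieldB !vfieldZ !bracket_f !vfieldZ derivationM; ring.
Qed.

Lemma curvature_linear Y Z : linear (fun X => curvature nabla X Y Z).
Proof.
move=> h X X' /=; rewrite /curvature.
have -> : bracket (h *: X + X') Y = h *: bracket X Y - Y h *: X + bracket X' Y.
  by rewrite -bracketZl; apply: vfieldP => f; rewrite !(vfieldD, bracket_f,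
    derivationD); ring.
rewrite !(nablaDl, nablaBl, nablaZl, nablaDr, nablaZr).
apply: (g_nondegenerate rm) => U.
rewrite !(metricDl rm, metricBl rm, metricZl rm); ring.
Qed.

Lemma lie_metricE W X Y :
  lie_derivative W g X Y = g (nabla X W) Y + g X (nabla Y W).
Proof.
rewrite /lie_derivative (lc_metric lc) !bracketE (metricBl rm) (metricBr rm); ring.
Qed.

(** The commutator of two Lie derivatives is the Lie derivative along the bracket, by the Jacobi
    identity. *)
Lemma lie_metric_bracket W V X Y :
  lie_derivative (bracket W V) g X Y =
    (W (lie_derivative V g X Y) - lie_derivative V g (bracket W X) Y
       - lie_derivative V g X (bracket W Y))
  - (V (lie_derivative W g X Y) - lie_derivative W g (bracket V X) Y
       - lie_derivative W g X (bracket V Y)).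
Proof.
rewrite /lie_derivative !derivationB bracket_f.
have E Z : bracket (bracket W V) Z = bracket W (bracket V Z) - bracket V (bracket W Z).
  by rewrite jacobi addrK.
rewrite !E (metricBl rm) (metricBr rm); ring.
Qed.

(** The Lie derivative of the connection along [W], a tensor in X and Y. *)
Definition lie_connection W X Y : 'Vect(M) :=
  bracket W (nabla X Y) - nabla (bracket W X) Y - nabla X (bracket W Y).

Lemma lie_connection_sym W X Y : lie_connection W X Y = lie_connection W Y X.
Proof.
apply/eqP; rewrite -subr_eq0 /lie_connection; apply/eqP.
have H1 : nabla X Y = bracket X Y + nabla Y X by rewrite bracketE subrK.
have H2 : nabla (bracket W X) Y = bracket (bracket W X) Y + nabla Y (bracket W X).
  by rewrite (bracketE (bracket W X)) subrK.
have H3 : nabla X (bracket W Y) = bracket X (bracket W Y) + nabla (bracket W Y) X.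
  by rewrite (bracketE X) subrK.
have H4 : bracket W (nabla X Y) = bracket W (bracket X Y) + bracket W (nabla Y X).
  by rewrite -[bracket X Y](addrK (nabla Y X)) -H1 bracketBr subrK.
rewrite H4 H2 H3 jacobi; apply: vfieldP => f; rewrite vfield0 !(vfieldD, vfieldB,
  vfieldN).
ring.
Qed.

(* (nabla_X (L_W g)) (Y, Z) *)
Definition nabla_lie W X Y Z : 'C^oo(M) :=
  X (lie_derivative W g Y Z) - lie_derivative W g (nabla X Y) Z
    - lie_derivative W g Y (nabla X Z).

(** Obtained by taking the Lie derivative along [W] of the compatibility of [nabla] with [g]. *)
Lemma lie_connection_skew W X Y Z :
  g (lie_connection W X Y) Z + g Y (lie_connection W X Z) = nabla_lie W X Y Z.
Proof.
rewrite /nabla_lie /lie_derivative /lie_connection !derivationB.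
have : bracket W X (g Y Z) = g (nabla (bracket W X) Y) Z + g Y (nabla (bracket W X) Z).
  exact: (lc_metric lc).
have : W (X (g Y Z)) = W (g (nabla X Y) Z) + W (g Y (nabla X Z)).
  by rewrite (lc_metric lc Y Z X) derivationD.
rewrite bracket_f => -> H.
have -> : X (W (g Y Z)) = W (g (nabla X Y) Z) + W (g Y (nabla X Z))
   - (g (nabla (bracket W X) Y) Z + g Y (nabla (bracket W X) Z)).
  by rewrite -H opprB addrC subrK.
rewrite (lc_metric lc (bracket W Y) Z X) (lc_metric lc Y (bracket W Z) X).
rewrite !(metricBl rm) !(metricBr rm); ring.
Qed.

(** As for the Koszul formula: symmetry in the first two slots and a known symmetrization in the
    last two determine the tensor. *)
Lemma lie_connection_koszul W X Y Z :
  2 * g (lie_connection W X Y) Z =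
  nabla_lie W X Y Z + nabla_lie W Y X Z - nabla_lie W Z X Y.
Proof.
rewrite -!lie_connection_skew (lie_connection_sym W Y X) (lie_connection_sym W Z X).
rewrite (lie_connection_sym W Z Y) !(metricC rm X) !(metricC rm Y). ring.
Qed.

Definition hess u X Y : 'C^oo(M) := X (Y u) - nabla X Y u.

Lemma lie_hess W u X Y :
  W (hess u X Y) - hess u (bracket W X) Y - hess u X (bracket W Y) =
  hess (W u) X Y - lie_connection W X Y u.
Proof. rewrite /hess /lie_connection !(vfieldB, bracket_f, derivationB); ring. Qed.

Lemma hess_sym u X Y : hess u X Y = hess u Y X.
Proof.
have : bracket X Y u = nabla X Y u - nabla Y X u by rewrite bracketE vfieldB.
rewrite bracket_f /hess => H.
have -> : X (Y u) = nabla X Y u - nabla Y X u + Y (X u) by rewrite -H subrK.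
ring.
Qed.

Lemma hess_grad F u X Y : (forall Z, g F Z = Z u) -> hess u X Y = g (nabla X F) Y.
Proof. by move=> Fu; rewrite /hess -!Fu (lc_metric lc); ring. Qed.

End Connection.

(** * Kenmotsu geometry *)

Section KenmotsuGeometry.
Context {R : realType} {d : nat} {M : manifold R d.+1}.
Variables (g : 'Vect(M) -> 'Vect(M) -> 'C^oo(M)) (rm : riemannian_metric g).
Variables (nabla : 'Vect(M) -> 'Vect(M) -> 'Vect(M)) (lc : levi_civita g nabla).
Variables (xi : 'Vect(M)) (xi1 : g xi xi = 1).
Hypothesis nabla_xi : forall X, nabla X xi = X - g X xi *: xi.
Implicit Types (X Y Z U W : 'Vect(M)) (f h u : 'C^oo(M)) (p q : M).

Local Notation eta X := (g X xi).
Definition hor X Y : 'C^oo(M) := g X Y - g X xi * g Y xi.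

Lemma smooth_double_inj f h : 2 * f = 2 * h -> f = h.
Proof.
move=> H; apply: smooth_funE => p.
have := congr1 (fun h : 'C^oo(M) => h p) H; rewrite !mulr_natl !mulr2n !smoothD; lra.
Qed.

Lemma horC X Y : hor X Y = hor Y X.
Proof. by rewrite /hor (metricC rm) mulrC. Qed.

Lemma hor_xil X : hor xi X = 0.
Proof. rewrite /hor xi1 (metricC rm xi); ring. Qed.

Lemma nabla_eta X Y : X (eta Y) = eta (nabla X Y) + hor X Y.
Proof. by rewrite (lc_metric lc) nabla_xi (metricBr rm) (metricZr rm) /hor (metricC
  rm Y X). Qed.

Lemma nabla_hor U X Y : U (hor X Y) = hor (nabla U X) Y + hor X (nabla U Y)
  - hor U X * eta Y - eta X * hor U Y.
Proof. by rewrite /hor derivationB derivationM (lc_metric lc) !nabla_eta /hor;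
  ring. Qed.

Lemma lie_xi_metric X Y : lie_derivative xi g X Y = 2 * hor X Y.
Proof.
rewrite (lie_metricE rm lc) !nabla_xi (metricBl rm) (metricBr rm) (metricZl rm)
  (metricZr rm) (metricC rm xi) /hor; ring.
Qed.

Lemma xi_eta X : xi (eta X) = eta (bracket xi X).
Proof.
rewrite nabla_eta hor_xil addr0 (bracketE lc) nabla_xi !(metricBl rm) (metricZl rm)
  xi1; ring.
Qed.

Lemma curvature_xi X Y : curvature nabla X Y xi = eta X *: Y - eta Y *: X.
Proof.
rewrite /curvature (nabla_xi Y) (nabla_xi X) !(nablaBr lc) !(nablaZr lc) !nabla_xi
  !nabla_eta.
apply: (g_nondegenerate rm) => Z.
rewrite (bracketE lc) !(metricBl rm, metricDl rm, metricZl rm) (horC Y X); ring.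
Qed.

(** [lie_connection_koszul] for a multiple of [hor]; the last term appears because [hor] is not
    parallel, see [nabla_hor]. It serves for [xi] with factor 1 and for the field acting on the
    leaves. *)
Lemma lie_connection_conformal W sig X Y Z :
  (forall X Y, lie_derivative W g X Y = 2 * (sig * hor X Y)) ->
  g (lie_connection nabla W X Y) Z =
  X sig * hor Y Z + Y sig * hor X Z - Z sig * hor X Y - 2 * sig * hor X Y * eta Z.
Proof.
move=> H; apply: smooth_double_inj; rewrite (lie_connection_koszul rm lc) /nabla_lie !H.
rewrite !mulr_natl !derivationMn !derivationM !nabla_hor (horC Z X) (horC Z Y)
  (horC Y X).
ring.
Qed.

Lemma lie_connection_xi X Y : lie_connection nabla xi X Y = (- 2 * hor X Y) *: xi.
Proof.
apply: (g_nondegenerate rm) => Z.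
rewrite (@lie_connection_conformal xi 1) => [|U V]; last by rewrite lie_xi_metric mul1r.
by rewrite !derivation1 (metricZl rm) (metricC rm xi); ring.
Qed.

Lemma bracket_xi_nabla X Y : bracket xi (nabla X Y) =
  nabla (bracket xi X) Y + nabla X (bracket xi Y) - (2 * hor X Y) *: xi.
Proof.
have -> : bracket xi (nabla X Y) =
    lie_connection nabla xi X Y + nabla X (bracket xi Y) + nabla (bracket xi X) Y.
  by rewrite /lie_connection !subrK.
by rewrite lie_connection_xi mulNr scaleNr addrC [- _ + _]addrC addrA.
Qed.

(** The Lie derivative of the curvature is the skew-symmetrized covariant derivative of
    [lie_connection], here the tensor -2 hor times [xi]; its [xi] components cancel. *)
Lemma lie_curvature_xi X Y Z : bracket xi (curvature nabla X Y Z) =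
  curvature nabla (bracket xi X) Y Z + curvature nabla X (bracket xi Y) Z
  + curvature nabla X Y (bracket xi Z)
  - 2 *: (hor Y Z *: X - hor X Z *: Y).
Proof.
rewrite /curvature !bracketBr !bracket_xi_nabla jacobi !(nablaDr lc, nablaBr lc,
  nablaDl lc, nablaZr lc).
rewrite !nabla_xi !derivationM.
apply: (g_nondegenerate rm) => U.
rewrite !(metricBl rm, metricDl rm, metricZl rm, metricNl rm).
have X2 (V : 'Vect(M)) : V 2 = 0 by rewrite derivationMn derivation1 mul0rn.
rewrite !derivationN !derivation1 !X2 !nabla_hor.
have -> : hor (bracket X Y) Z = hor (nabla X Y) Z - hor (nabla Y X) Z.
  by rewrite (bracketE lc) /hor !(metricBl rm); ring.
rewrite (horC Y X) (horC Y (nabla X Z)) /hor (metricC rm xi). ring.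
Qed.

End KenmotsuGeometry.

(** * The Ricci tensor along the Reeb field *)

Section EtaEinstein.
Context {R : realType} {d : nat} {M : manifold R d.+1}.
Variables (g : 'Vect(M) -> 'Vect(M) -> 'C^oo(M)) (rm : riemannian_metric g).
Variables (nabla : 'Vect(M) -> 'Vect(M) -> 'Vect(M)) (lc : levi_civita g nabla).
Variables (xi : 'Vect(M)) (xi1 : g xi xi = 1).
Hypothesis nabla_xi : forall X, nabla X xi = X - g X xi *: xi.
Variables (S : 'Vect(M) -> 'Vect(M) -> 'C^oo(M)) (S_ricci : ricci_tensor g nabla S).
Implicit Types (X Y Z U W : 'Vect(M)) (f h u : 'C^oo(M)) (p q : M).

Local Notation eta X := (g X xi).
Local Notation hor := (hor g xi).

(** Provides the trace that [rank_bound] and the frame lemmas take as hypothesis. *)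
Lemma trace_xi : trace_of g (fun X => g X xi *: xi - X) (S xi xi).
Proof.
move=> p e oe; rewrite (S_ricci oe); apply: eq_bigr => i _.
by rewrite (curvature_xi rm lc nabla_xi) xi1 scale1r.
Qed.

Lemma frame_orthonormal p (e : 'I_d.+1 -> 'Vect(M)) : orthogonal_fields g e ->
  (forall i, g (e i) (e i) p = 1) -> orthonormal_at g p e.
Proof.
move=> oe e1 i j; have [->|ij] := eqVneq i j; first exact: e1.
by rewrite oe.
Qed.

Lemma frame_dim p (e : 'I_d.+1 -> 'Vect(M)) : (forall i, g (e i) (e i) p = 1) ->
  \sum_i g (e i) (e i) p = d%:R + 1.
Proof.
move=> e1; under eq_bigr => i _ do rewrite e1.
by rewrite sumr_const card_ord -natr1.
Qed.

Lemma frame_contraction p (e : 'I_d.+1 -> 'Vect(M)) L Z : orthogonal_fields g e ->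
  e ord0 = xi -> (forall i, g (e i) (e i) p = 1) -> scalar L ->
  \sum_i L (e i) p * g Z (e i) p = L Z p.
Proof.
move=> oe e0 e1 Ll; rewrite (frame_expansion rm xi1 trace_xi Z oe e0 e1 Ll).
by apply: eq_bigr => i _; rewrite mulrC.
Qed.

Lemma ricci_xi_xi : S xi xi = cstf (- d%:R).
Proof.
apply: smooth_funE => p; rewrite cstfE.
have [e [oe e0 e1]] := exists_orthogonal_frame rm xi1 p.
rewrite (trace_xi (frame_orthonormal oe e1)).
under eq_bigr => i _ do rewrite (metricBl rm) (metricZl rm) smoothD smoothN smoothM.
have L : scalar (g ^~ xi) by move=> h X Y; rewrite (metricDl rm) (metricZl rm).
rewrite sumrB frame_dim // (frame_contraction xi oe e0 e1 L) xi1 smooth1; ring.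
Qed.

Lemma horE X Y : hor X Y = g X Y - eta X * eta Y. Proof. by []. Qed.

Lemma hor_scalar Z : scalar (hor ^~ Z).
Proof. by move=> h X Y; rewrite /hor !(metricDl rm) !(metricZl rm); ring. Qed.

Lemma lie_ricci_xi Y Z :
  xi (S Y Z) = S (bracket xi Y) Z + S Y (bracket xi Z) - cstf (2 * d%:R) * hor Y Z.
Proof.
apply: smooth_funE => p; rewrite !smoothD smoothN smoothM cstfE.
set v := hor Y Z p.
have [e [oe e0 e1 tr]] := trace_derivative rm xi1 trace_xi lc p xi.
have Al := curvature_linear rm lc Y Z.
rewrite (tr _ _ Al); last by move=> q e' oe'; rewrite (S_ricci oe').
set A := fun X => curvature nabla X Y Z in Al *.
(* Replaces the covariant derivative in [tr] by a Lie derivative. The two correction terms have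
   traces eta (A xi) of opposite sign, so they cancel. *)
have nE U : nabla xi U = bracket xi U + U - eta U *: xi.
  rewrite (bracketE lc) nabla_xi; apply: (g_nondegenerate rm) => V.
  by rewrite !(metricBl rm, metricDl rm); ring.
have AB U V : A (U - V) = A U - A V.
  by have := Al (-1) V U; rewrite !scaleN1r ![- _ + _]addrC.
have AD U V : A (U + V) = A U + A V by have := Al 1 U V; rewrite !scale1r.
have AZ h V : A (h *: V) = h *: A V.
  have A0 : A 0 = 0 by have := AB xi xi; rewrite !subrr.
  by have := Al h V 0; rewrite A0 !addr0.
have term i : g (nabla xi (A (e i)) - A (nabla xi (e i))) (e i) p =
    g (curvature nabla (e i) (bracket xi Y) Z) (e i) p
    + g (curvature nabla (e i) Y (bracket xi Z)) (e i) p
    - 2 * v * g (e i) (e i) p + 2 * (hor (e i) Z p * g Y (e i) p)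
    - eta (A (e i)) p * g xi (e i) p + eta (e i) p * g (A xi) (e i) p.
  rewrite !nE AB AD AZ {1}/A (lie_curvature_xi rm lc nabla_xi) -/(A (e i)) -/(A
    (bracket xi (e i))).
  rewrite !(metricBl rm, metricDl rm, metricZl rm) /v !(smoothD, smoothN, smoothM).
  rewrite smooth1; ring.
under eq_bigr => i _ do rewrite term.
rewrite !big_split /= !sumrN -!mulr_sumr frame_dim //.
have c1 := frame_contraction (L := hor ^~ Z) Y oe e0 e1 (hor_scalar Z).
have c2 := frame_contraction (L := fun V => eta (A V)) xi oe e0 e1.
have c3 := frame_contraction (L := fun V => eta V) (A xi) oe e0 e1.
rewrite c1 -/v c2; last by move=> h U V; rewrite Al (metricDl rm) (metricZl rm).
rewrite c3; last by move=> h U V; rewrite (metricDl rm) (metricZl rm).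
rewrite -(S_ricci (frame_orthonormal oe e1)) -(S_ricci (frame_orthonormal oe e1)).
rewrite -/v; ring.
Qed.

Hypothesis d0 : (0 < d)%N.

Lemma exists_unit_horizontal p : exists X, eta X = 0 /\ g X X p = 1.
Proof.
have [e [oe e0 e1]] := exists_orthogonal_frame rm xi1 p.
exists (e (inord 1)); split; last exact: e1.
by rewrite -e0 oe // -val_eqE /= inordK.
Qed.

Lemma hor_cancel h : (forall X Y, h * hor X Y = 0) -> h = 0.
Proof.
move=> H; apply: smooth_funE => p; have [X [X0 X1]] := exists_unit_horizontal p.
have := congr1 (fun h : 'C^oo(M) => h p) (H X X).
by rewrite horE X0 smoothM smoothD smoothN smoothM smooth0 mulr0 subr0 X1 mulr1.
Qed.

Variables (alpha beta : 'C^oo(M)).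
Hypothesis SE : forall X Y, S X Y = alpha * g X Y + beta * (eta X * eta Y).

Lemma alphaE : alpha = cstf (- d%:R) - beta.
Proof. by rewrite -ricci_xi_xi SE xi1; ring. Qed.

(** Put [SE] into [lie_ricci_xi]. As eta is invariant along [xi] and [g] changes by 2 hor, every
    term is a multiple of [hor], which [hor_cancel] removes. *)
Lemma xi_beta : xi beta = - 2 * beta.
Proof.
apply/eqP; rewrite -subr_eq0; apply/eqP/hor_cancel => X Y.
have xig : xi (g X Y) = 2 * hor X Y + g (bracket xi X) Y + g X (bracket xi Y).
  by rewrite -(lie_xi_metric rm lc nabla_xi) /lie_derivative; ring.
have cE : cstf (2 * d%:R) = - 2 * cstf (- d%:R) :> 'C^oo(M).
  by apply: smooth_funE => p; rewrite smoothM smoothN !cstfE -[smooth_val 2 p]/(1 +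
    1 : R); ring.
have := lie_ricci_xi X Y; rewrite !SE alphaE cE derivationD !derivationM
  derivationB vfield_cst xig.
rewrite !(xi_eta rm lc xi1 nabla_xi) => /eqP; rewrite -subr_eq0 => /eqP H.
rewrite -oppr0 -[in RHS]H /hor; ring.
Qed.

End EtaEinstein.

(** * Tracing the curvature on a gradient *)

Section HessianTrace.
Context {R : realType} {d : nat} {M : manifold R d.+1}.
Variables (g : 'Vect(M) -> 'Vect(M) -> 'C^oo(M)) (rm : riemannian_metric g).
Variables (nabla : 'Vect(M) -> 'Vect(M) -> 'Vect(M)) (lc : levi_civita g nabla).
Variables (xi : 'Vect(M)) (xi1 : g xi xi = 1).
Hypothesis nabla_xi : forall X, nabla X xi = X - g X xi *: xi.
Variables (S : 'Vect(M) -> 'Vect(M) -> 'C^oo(M)) (S_ricci : ricci_tensor g nabla S).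
Implicit Types (X Y Z U W : 'Vect(M)) (f h u : 'C^oo(M)) (p q : M).
Variables (alpha beta : 'C^oo(M)).
Local Notation eta X := (g X xi).
Local Notation hor := (hor g xi).
Hypothesis SE : forall X Y, S X Y = alpha * g X Y + beta * (eta X * eta Y).

Variables (D F : 'Vect(M)) (f u a s : 'C^oo(M)).
(* [F] is the gradient of [u]; [hess_trace] is applied to [u = f] with [s = 0] and
   to [u = W f] with [s = -2]. *)
Hypothesis gF : forall X, g F X = X u.
Hypothesis xi_f : xi f = 0.
Hypothesis xi_u : xi u = 0.
Hypothesis ds : forall X, X s = 0.
Hypothesis nabla_D : forall X,
  nabla X D = (2 * beta) *: (X - eta X *: xi) - X f *: xi - eta X *: D.
Hypothesis nabla_F : forall X, nabla X F =
  a *: (X - eta X *: xi) + (s * X f) *: D - X u *: xi - eta X *: F.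

Lemma curvature_grad X Y : curvature nabla X Y F =
  X a *: (Y - eta Y *: xi) - Y a *: (X - eta X *: xi)
  - (2 * a) *: (eta Y *: X - eta X *: Y)
  + (2 * beta * s) *: (Y f *: (X - eta X *: xi) - X f *: (Y - eta Y *: xi))
  + X u *: Y - Y u *: X.
Proof.
rewrite /curvature !nabla_F !(nablaBr lc, nablaDr lc, nablaZr lc) !nabla_F !nabla_D
  !nabla_xi.
rewrite !derivationM !ds !bracket_f.
rewrite !(nabla_eta rm lc nabla_xi) (horC rm xi Y X).
apply: (g_nondegenerate rm) => U.
rewrite !(metricBl rm, metricDl rm, metricZl rm, metricNl rm) (bracketE lc)
  !(metricBl rm).
ring.
Qed.

(** Computes S(Y, F) twice: by tracing [curvature_grad], and from [SE], where eta(F) = xi u = 0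
    leaves alpha times Y u. *)
Lemma hess_trace Y :
  (cstf d%:R - 1) * Y a + (xi a + 2 * cstf d%:R * a) * eta Y =
  beta * Y u + 2 * (cstf d%:R - 1) * beta * s * Y f.
Proof.
have : S Y F = - cstf d%:R * Y u - beta * Y u.
  rewrite SE (alphaE rm lc xi1 nabla_xi S_ricci SE) (metricC rm Y) !gF xi_u mulr0
    mulr0 addr0.
  by rewrite /cstf scaleNr; ring.
move=> H; apply: smooth_funE => p.
have [e [oe e0 e1]] := exists_orthogonal_frame rm xi1 p.
have := congr1 (fun h : 'C^oo(M) => h p) H.
rewrite (S_ricci (frame_orthonormal oe e1)).
have contr L Z : scalar L -> \sum_i L (e i) p * g Z (e i) p = L Z p.
  exact: (frame_contraction rm lc xi1 nabla_xi S_ricci).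
have eta_lin : scalar (g ^~ xi) by move=> h V W; rewrite (metricDl rm) (metricZl rm).
have df_lin h : scalar (fun V : 'Vect(M) => V h) by move=> l V W; rewrite vfieldD
  vfieldZ.
pose k1 := (- Y a - 2 * a * eta Y + 2 * beta * s * Y f - Y u) p.
pose k2 := (Y a - 2 * beta * s * Y f) p.
pose k3 := (2 * a) p.
pose k4 := (- (2 * beta * s)) p.
have -> : \sum_i g (curvature nabla (e i) Y F) (e i) p =
    \sum_i e i a p * g (Y - eta Y *: xi) (e i) p
    + k1 * (\sum_i g (e i) (e i) p)
    + k2 * (\sum_i eta (e i) p * g xi (e i) p)
    + k3 * (\sum_i eta (e i) p * g Y (e i) p)
    + k4 * (\sum_i e i f p * g (Y - eta Y *: xi) (e i) p)
    + \sum_i e i u p * g Y (e i) p.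
  rewrite !mulr_sumr -!big_split; apply: eq_bigr => i _ /=.
  rewrite curvature_grad !(metricBl rm, metricDl rm, metricZl rm) /k1 /k2 /k3 /k4
    !(smoothD, smoothM, smoothN) smooth1.
  ring.
rewrite (frame_dim e1) (contr _ _ eta_lin) (contr _ _ eta_lin) !(contr _ _ (df_lin _)).
rewrite !(vfieldB, vfieldZ) xi_f xi1.
rewrite /k1 /k2 /k3 /k4 !(smoothD, smoothM, smoothN, cstfE) smooth0 !smooth1 => H'.
lra.
Qed.

End HessianTrace.

(** * The soliton equation *)

Section Soliton.
Context {R : realType} {d : nat} {M : manifold R d.+1}.
Variables (g : 'Vect(M) -> 'Vect(M) -> 'C^oo(M)) (rm : riemannian_metric g).
Variables (nabla : 'Vect(M) -> 'Vect(M) -> 'Vect(M)) (lc : levi_civita g nabla).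
Variables (xi : 'Vect(M)) (xi1 : g xi xi = 1).
Hypothesis nabla_xi : forall X, nabla X xi = X - g X xi *: xi.
Variables (S : 'Vect(M) -> 'Vect(M) -> 'C^oo(M)) (S_ricci : ricci_tensor g nabla S).
Implicit Types (X Y Z U : 'Vect(M)) (h u : 'C^oo(M)) (p q : M).
Hypothesis d0 : (0 < d)%N.
Variables (alpha beta : 'C^oo(M)).
Local Notation eta X := (g X xi).
Local Notation hor := (hor g xi).
Hypothesis SE : forall X Y, S X Y = alpha * g X Y + beta * (eta X * eta Y).

Variables (V : 'Vect(M)) (k0 k : 'C^oo(M)).
Hypothesis dk0 : forall X, X k0 = 0.
Hypothesis dk : forall X, X k = 0.
Hypothesis lieV : forall X Y, lie_derivative V g X Y =
  (2 * beta + k0) * hor X Y + 2 * k * (eta X * eta Y).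

Let f := eta V.
Let xb := xi_beta rm lc xi1 nabla_xi S_ricci d0 SE.

Lemma derivation2 X : X 2 = 0. Proof. by rewrite derivationMn derivation1 mul0rn. Qed.

Lemma xi_g X Y : xi (g X Y) =
  2 * (g X Y - eta X * eta Y) + g (bracket xi X) Y + g X (bracket xi Y).
Proof. rewrite -horE -(lie_xi_metric rm lc nabla_xi) /lie_derivative; ring. Qed.

(** The Lie derivative of eta along [V] is df, since eta is closed. *)
Lemma lieV_eta X : V (eta X) = eta (bracket V X) + X f.
Proof.
rewrite /f !(nabla_eta rm lc nabla_xi) (bracketE lc) (metricBl rm) (horC rm xi V
  X); ring.
Qed.

Definition soliton_grad : 'Vect(M) := (2 * k) *: xi - bracket xi V.
Local Notation D := soliton_grad.

(** The soliton equation on the pair (X, xi), combined with [lieV_eta]. *)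
Lemma g_soliton_grad X : g D X = X f.
Proof.
have := lieV X xi; rewrite /lie_derivative lieV_eta xi1 [hor X xi]horC // hor_xil //.
have -> : bracket V xi = - bracket xi V.
  by apply: vfieldP => h; rewrite vfieldN !bracket_f opprB.
rewrite (metricNr rm) /D (metricBl rm) (metricZl rm) (metricC rm (bracket xi V))
  (metricC rm xi) => H.
apply: (eq_of_sub (esym H)); ring.
Qed.

Lemma xi_f : xi f = k.
Proof.
have := lieV xi xi; rewrite /lie_derivative xi1 derivation1 hor_xil // mulr1 mulr0
  add0r mulr1.
rewrite [g xi (bracket _ _)](metricC rm) => H.
have H2 := lieV_eta xi; rewrite xi1 derivation1 in H2.
have H3 : eta (bracket V xi) = - xi f by apply: (eq_of_sub (esym H2)); ring.
rewrite H3 in H; apply: smooth_double_inj; apply: (eq_of_sub H); ring.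
Qed.

(** Twice the Hessian is the Lie derivative of [g] along the gradient 2k xi - [xi, V].
    [lie_metric_bracket] reduces the bracket to the known Lie derivatives along [xi] and [V]. *)
Lemma hess_potential X Y : hess nabla f X Y =
  (2 * k + 2 * beta) * hor X Y + 2 * k * (eta X * eta Y) - X f * eta Y - Y f * eta X.
Proof.
have hg Z U := hess_grad lc Z U g_soliton_grad.
have : lie_derivative D g X Y = 2 * hess nabla f X Y.
  rewrite (lie_metricE rm lc) (metricC rm X) -!hg (hess_sym lc f Y X); ring.
have -> : lie_derivative D g X Y = 4 * k * hor X Y - lie_derivative (bracket xi V)
  g X Y.
  rewrite !(lie_metricE rm lc) /D !(nablaBr lc) !(nablaZr lc) !nabla_xi.
  have dk2 Z : Z (2 * k) = 0 by rewrite derivationM derivation2 dk; ring.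
  rewrite !dk2 !(metricBl rm, metricDl rm, metricZl rm) !(metricBr rm, metricDr rm,
    metricZr rm) (metricC rm xi) horE; ring.
rewrite (lie_metric_bracket rm) !lieV !(lie_xi_metric rm lc nabla_xi).
rewrite !horE !(derivation2, dk, dk0, xb, derivationN, derivationB, derivationM,
  derivationD) !(xi_eta rm lc xi1 nabla_xi) !xi_g.
have -> : V (g X Y) = lie_derivative V g X Y + g (bracket V X) Y + g X (bracket V Y).
  by rewrite /lie_derivative; ring.
rewrite lieV !lieV_eta !horE => H; apply: smooth_double_inj; apply: (eq_of_sub
  (esym H)); ring.
Qed.

(** In [lie_hess] along [xi], the Hessian of the constant xi f = k vanishes and the connection term
    gives 2k hor, whereas [hess_potential] gives 4k hor. *)
Lemma soliton_const_eq0 : k = 0.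
Proof.
have H X Y : k * hor X Y = 0.
  have := lie_hess nabla xi f X Y.
  rewrite xi_f (lie_connection_xi rm lc nabla_xi) vfieldZ xi_f !hess_potential.
  rewrite !horE !(derivation2, dk, xb, derivationN, derivationB, derivationM,
    derivationD) !(xi_eta rm lc xi1 nabla_xi) !xi_g.
  have xf Z : bracket xi Z f = xi (Z f).
    by rewrite bracket_f xi_f dk subr0.
  rewrite !xf /hess !dk derivation0.
  move=> H; apply: smooth_double_inj; apply: (eq_of_sub H); ring.
exact: (hor_cancel rm xi1 d0 H).
Qed.

End Soliton.

(** * A conformal field on the leaves *)

Section LeafField.
Context {R : realType} {d : nat} {M : manifold R d.+1}.
Variables (g : 'Vect(M) -> 'Vect(M) -> 'C^oo(M)) (rm : riemannian_metric g).
Variables (nabla : 'Vect(M) -> 'Vect(M) -> 'Vect(M)) (lc : levi_civita g nabla).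
Variables (xi : 'Vect(M)) (xi1 : g xi xi = 1).
Hypothesis nabla_xi : forall X, nabla X xi = X - g X xi *: xi.
Variables (S : 'Vect(M) -> 'Vect(M) -> 'C^oo(M)) (S_ricci : ricci_tensor g nabla S).
Implicit Types (X Y Z U : 'Vect(M)) (h u : 'C^oo(M)) (p q : M).
Hypothesis d0 : (0 < d)%N.
Variables (alpha beta : 'C^oo(M)).
Local Notation eta X := (g X xi).
Local Notation hor := (hor g xi).
Hypothesis SE : forall X Y, S X Y = alpha * g X Y + beta * (eta X * eta Y).

Variables (V D : 'Vect(M)) (f k0 : 'C^oo(M)).
Hypothesis lieV : forall X Y, lie_derivative V g X Y = (2 * beta + k0) * hor X Y.
Hypothesis fE : eta V = f.
Hypothesis gD : forall X, g D X = X f.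
Hypothesis xi_f : xi f = 0.
Hypothesis hess_f : forall X Y,
  hess nabla f X Y = 2 * beta * hor X Y - X f * eta Y - Y f * eta X.

Let xb := xi_beta rm lc xi1 nabla_xi S_ricci d0 SE.

Lemma nabla_grad X :
  nabla X D = (2 * beta) *: (X - eta X *: xi) - X f *: xi - eta X *: D.
Proof.
apply: (g_nondegenerate rm) => Y.
rewrite -(hess_grad lc X Y gD) hess_f.
by rewrite !(metricBl rm, metricZl rm) gD (metricC rm xi Y) /hor; ring.
Qed.

Lemma d_beta Y :
  2 * (cstf d%:R - 1) * (Y beta + 2 * beta * eta Y) = beta * Y f.
Proof.
have nF X : nabla X D =
    (2 * beta) *: (X - eta X *: xi) + (0 * X f) *: D - X f *: xi - eta X *: D.
  by rewrite mul0r scale0r addr0 nabla_grad.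
have := hess_trace rm lc xi1 nabla_xi S_ricci SE gD xi_f xi_f
  (fun X => derivation0 X) nabla_grad nF Y.
rewrite !derivationM !derivation2 xb => H; apply: (eq_of_sub H); ring.
Qed.

(* The component of the soliton field tangent to the leaves of [eta = 0] and
   invariant along [xi] acts on the leaves by conformal changes. *)
Lemma exists_leaf_field : exists W, eta W = 0 /\ forall X Y,
  lie_derivative W g X Y = 2 * ((cstf 2^-1 * k0 - f) * hor X Y).
Proof.
exists (V - f *: xi - cstf 2^-1 *: D); split.
  by rewrite !(metricBl rm, metricZl rm) xi1 gD xi_f fE; ring.
move=> X Y.
have nW Z : nabla Z (V - f *: xi - cstf 2^-1 *: D) =
    nabla Z V - (Z f *: xi + f *: (Z - eta Z *: xi))
    - cstf 2^-1 *: ((2 * beta) *: (Z - eta Z *: xi) - Z f *: xi - eta Z *: D).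
  by rewrite !(nablaBr lc) !(nablaZr lc) nabla_grad nabla_xi vfield_cst scale0r add0r.
rewrite (lie_metricE rm lc) !nW.
rewrite !(metricBl rm, metricDl rm, metricZl rm) !(metricBr rm, metricDr rm,
  metricZr rm).
have := lieV X Y; rewrite (lie_metricE rm lc) => H.
have -> : g (nabla X V) Y = (2 * beta + k0) * hor X Y - g X (nabla Y V).
  by rewrite -H; ring.
rewrite (metricC rm X D) !gD (metricC rm xi Y) /hor; apply: smooth_funE => p.
rewrite !(smoothD, smoothM, smoothN, cstfE) !smooth1; lra.
Qed.

End LeafField.

(** * Vanishing of beta *)

Section Rigidity.
Context {R : realType} {d : nat} {M : manifold R d.+1}.
Variables (g : 'Vect(M) -> 'Vect(M) -> 'C^oo(M)) (rm : riemannian_metric g).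
Variables (nabla : 'Vect(M) -> 'Vect(M) -> 'Vect(M)) (lc : levi_civita g nabla).
Variables (xi : 'Vect(M)) (xi1 : g xi xi = 1).
Hypothesis nabla_xi : forall X, nabla X xi = X - g X xi *: xi.
Variables (S : 'Vect(M) -> 'Vect(M) -> 'C^oo(M)) (S_ricci : ricci_tensor g nabla S).
Implicit Types (X Y Z U : 'Vect(M)) (h u : 'C^oo(M)) (p q : M).
Hypothesis d0 : (0 < d)%N.
Variables (alpha beta : 'C^oo(M)).
Local Notation eta X := (g X xi).
Local Notation hor := (hor g xi).
Hypothesis SE : forall X Y, S X Y = alpha * g X Y + beta * (eta X * eta Y).

Variables (D W : 'Vect(M)) (f sig : 'C^oo(M)).
Hypothesis gD : forall X, g D X = X f.
Hypothesis xi_f : xi f = 0.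
Hypothesis hess_f : forall X Y,
  hess nabla f X Y = 2 * beta * hor X Y - X f * eta Y - Y f * eta X.
Hypothesis W_eta : eta W = 0.
Hypothesis dsig : forall X, X sig = - X f.
Hypothesis lieW : forall X Y, lie_derivative W g X Y = 2 * (sig * hor X Y).

Let xb := xi_beta rm lc xi1 nabla_xi S_ricci d0 SE.
Let w := W f.
Let c : 'C^oo(M) := 2 * (cstf d%:R - 1).
Let a := 2 * W beta + 4 * beta * sig + D f.

Lemma W_of_eta X : W (eta X) = eta (bracket W X).
Proof.
rewrite (nabla_eta rm lc nabla_xi) (bracketE lc) (metricBl rm).
have := nabla_eta rm lc nabla_xi X W; rewrite W_eta derivation0 (horC rm) => H.
by apply: (eq_of_sub (esym H)); ring.
Qed.

Lemma bracket_W_xi : bracket W xi = 0.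
Proof.
apply: (g_nondegenerate rm) => X; rewrite (metric0l rm).
have := lieW xi X; rewrite hor_xil // /lie_derivative (metricC rm xi X) W_of_eta
  (metricC rm xi) => H.
by apply: (eq_of_sub (esym H)); ring.
Qed.

Lemma xi_w : xi w = 0.
Proof.
have : bracket W xi f = 0 by rewrite bracket_W_xi.
by rewrite bracket_f xi_f derivation0 sub0r => /eqP; rewrite oppr_eq0 => /eqP.
Qed.

(** Identifies the gradient of [w] by Lie differentiating [gD] along [W]. *)
Lemma g_grad_w X : g (bracket W D + (2 * sig) *: D) X = X w.
Proof.
have := lieW D X; rewrite /lie_derivative /hor !gD xi_f mul0r subr0 bracket_f -/w => H.
rewrite (metricDl rm) (metricZl rm) gD; apply: (eq_of_sub (esym H)); ring.
Qed.

(** [lie_hess] along [W]. The connection term paired with [D] produces both the summand D f of [a]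
    and the term -2 df times df, because d sig = -df. *)
Lemma hess_w X Y : hess nabla w X Y =
  a * hor X Y - 2 * (X f * Y f) - X w * eta Y - Y w * eta X.
Proof.
have Wg U V : W (g U V) = 2 * (sig * hor U V) + g (bracket W U) V + g U (bracket W V).
  by rewrite -lieW /lie_derivative; ring.
have := lie_hess nabla W f X Y; rewrite -/w -(gD (lie_connection _ _ _ _)) (metricC
  rm D).
rewrite (lie_connection_conformal rm lc nabla_xi X Y D lieW) !dsig.
rewrite !hess_f !horE (metricC rm Y D) (metricC rm X D) !gD xi_f.
rewrite !(derivation2, derivationN, derivationB, derivationM, derivationD)
  !W_of_eta !Wg !bracket_f -/w horE => H.
apply: (eq_of_sub (esym H)); rewrite /a; ring.
Qed.

Lemma nabla_grad_w X : nabla X (bracket W D + (2 * sig) *: D) =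
  a *: (X - eta X *: xi) + (- 2 * X f) *: D - X w *: xi
  - eta X *: (bracket W D + (2 * sig) *: D).
Proof.
apply: (g_nondegenerate rm) => Y.
rewrite -(hess_grad lc X Y g_grad_w) hess_w.
rewrite !(metricBl rm) (metricDl rm) !(metricZl rm) g_grad_w (metricBl rm)
  (metricZl rm) gD (metricC rm xi Y) /hor; ring.
Qed.

Let dc X : X c = 0.
Proof. by rewrite /c derivationM derivation2 derivationB vfield_cst derivation1;
  ring. Qed.

Let nD := nabla_grad rm lc gD hess_f.

Let db Y : c * Y beta = beta * Y f - 2 * c * beta * eta Y.
Proof.
have H := d_beta rm lc xi1 nabla_xi S_ricci d0 SE gD xi_f hess_f Y.
by rewrite -H /c; ring.
Qed.

(** [hess_trace] for u = w and s = -2. Since [db] controls only c times the derivative of beta, all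
    identities are first multiplied by powers of [c]. *)
Lemma potential_constraint Y : beta * (w + 2 * c * sig + 2 * c * c) * Y f = 0.
Proof.
have ca : c * a = 2 * beta * w + c * (4 * beta * sig + D f).
  have := db W; rewrite W_eta -/w => H; apply: (eq_of_sub (congr1 (fun h => 2 * h) H)).
  by rewrite /a; ring.
have DD Z : Z (D f) = 4 * beta * Z f - 2 * eta Z * D f.
  by rewrite -(gD D) (lc_metric lc) (metricC rm D (nabla Z D)) !nD !(metricBl rm,
    metricZl rm) (metricC rm xi) (metricC rm Z) !gD xi_f; ring.
have cZa Z : c * Z a = 2 * Z beta * w + 2 * beta * Z w
    + c * (4 * Z beta * sig - 4 * beta * Z f + Z (D f)).
  have Z4 : Z 4 = 0 by rewrite derivationMn derivation1 mul0rn.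
  have := congr1 Z ca; rewrite !(Z4, derivation2, dc, dsig, derivationM,
    derivationD) => H.
  apply: (eq_of_sub H); ring.
have cxa : c * xi a = - 2 * (c * a).
  by rewrite cZa DD xb xi_f xi_w xi1 ca; ring.
have nF X : nabla X (bracket W D + (2 * sig) *: D) =
  a *: (X - eta X *: xi) + (- 2 * X f) *: D - X w *: xi
  - eta X *: (bracket W D + (2 * sig) *: D) by exact: nabla_grad_w.
have ds X : X (- 2 : 'C^oo(M)) = 0 by rewrite derivationN derivation2 oppr0.
have := hess_trace rm lc xi1 nabla_xi S_ricci SE g_grad_w xi_f xi_w ds nD nF Y.
set k : 'C^oo(M) := cstf d%:R - 1 => T.
have E : cstf d%:R = k + 1 by rewrite subrK.
have {}T : c * (c * Y a) + 2 * (c * xi a + (c + 2) * (c * a)) * eta Y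
   = 2 * c * (beta * Y w) - 4 * c * c * beta * Y f.
  by apply: (eq_of_sub (congr1 (fun h => 2 * c * h) T)); rewrite E /c -/k; ring.
have cYa : c * (c * Y a) = 2 * (c * Y beta) * w + 2 * c * beta * Y w
    + c * (4 * (c * Y beta) * sig - 4 * c * beta * Y f + c * Y (D f)).
  by rewrite cZa; ring.
apply: smooth_double_inj; rewrite cYa cxa ca db DD in T.
by apply: (eq_of_sub T); ring.
Qed.

(** Multiplying the product rule by [h] kills the term with X h. This expresses that the derivatives
    of [u] vanish where [h] does not, without restricting to an open subset. *)
Lemma zero_product_derivative h u X : h * u = 0 -> (h * h) * X u = 0.
Proof.
move=> hu; have := congr1 X hu; rewrite derivationM derivation0 => /(congr1 (fun l
  => h * l)) H.
apply: (eq_of_sub H); rewrite mulr0 subr0 !mulrDr mulrCA hu; ring.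
Qed.

Lemma zero_product_at h u p : h * u = 0 -> h p != 0 -> u p = 0.
Proof.
move=> /(congr1 (fun l : 'C^oo(M) => l p)); rewrite smoothM smooth0 => /eqP.
by rewrite mulf_eq0 => /orP[/eqP ->|/eqP //]; rewrite eqxx.
Qed.

Hypothesis rotation : forall X, eta X = 0 ->
  exists Y, [/\ eta Y = 0, g X Y = 0 & g Y Y = g X X].

(* Where [beta * df] does not vanish, [potential_constraint] expresses [w]
   through [f] to second order; comparing the Hessians of [w] and [f] forces
   [df] tensor [df] to be a multiple of the horizontal metric. *)
Lemma beta_df Y : beta * Y f = 0.
Proof.
apply: smooth_funE => p; apply/eqP/negPn/negP; rewrite smooth0 => h0.
set h := beta * Y f in h0; pose t := w + 2 * c * sig + 2 * c * c.
have ht : h * t = 0 by rewrite /h mulrAC potential_constraint.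
have hXt X : h * h * X t = 0 by exact: zero_product_derivative.
have hh0 : (h * h) p != 0 by rewrite smoothM mulf_neq0.
have dt X : X t = X w - 2 * c * X f.
  by rewrite /t !(dc, derivation2, dsig, derivationD, derivationM); ring.
have d2t X Z : Z (X t) p = 0.
  apply: (@zero_product_at ((h * h) * (h * h))); last by rewrite smoothM mulf_neq0.
  exact: zero_product_derivative.
have ht_p X : hess nabla w X X p = (2 * c * hess nabla f X X) p.
  have H1 := d2t X X; have H2 := zero_product_at (hXt (nabla X X)) hh0.
  rewrite !dt in H1 H2; rewrite !(dc, derivation2, derivationB, derivationM) in H1.
  rewrite /hess !(smoothD, smoothN, smoothM) in H1 H2 *.
  rewrite !smooth0 in H1.
  apply: (eq_of_sub (etrans H1 (esym H2))); rewrite smooth1; ring.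
have main X : eta X = 0 -> a p * g X X p - 2 * (X f p) ^+ 2 = 4 * c p * beta p * g
  X X p.
  move=> X0; have := ht_p X; rewrite hess_w hess_f !horE X0.
  by rewrite !(smoothD, smoothN, smoothM) smooth0 smooth1 => H; apply: (eq_of_sub
    H); ring.
have D0 : eta D = 0 by rewrite gD.
(* [Z] is as long as the gradient [D] but orthogonal to it, so Z f = 0. Subtracting [main] for [Z]
   from [main] for [D] leaves the square of g D D at [p] equal to 0. *)
have [Z [Z0 DZ ZZ]] := rotation D0.
have m1 := main D D0; have m2 := main Z Z0.
rewrite -(gD D) in m1; rewrite -(gD Z) DZ ZZ smooth0 in m2.
have DDp : g D D p = 0.
  have : g D D p ^+ 2 = 0 by lra.
  by move=> /eqP; rewrite sqrf_eq0 => /eqP.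
move: h0; rewrite /h -gD smoothM (null_metric rm) // mulr0 eqxx; by [].
Qed.

Lemma beta_eq0 : beta = 0.
Proof.
have H X Y : beta * beta * beta * hor X Y = 0.
  have := congr1 X (beta_df Y); rewrite derivationM derivation0 => /(congr1 (fun h
    => beta * h)).
  have := hess_f X Y; rewrite /hess => H1 H2; apply: smooth_double_inj.
  have -> : 2 * (beta * beta * beta * hor X Y) = beta * beta * (2 * beta * hor X Y)
    by ring.
  have -> : 2 * beta * hor X Y = X (Y f) - nabla X Y f + X f * eta Y + Y f * eta X.
    by rewrite H1; ring.
  have e1 := beta_df (nabla X Y); have e2 := beta_df X; have e3 := beta_df Y.
  have -> : beta * beta * (X (Y f) - nabla X Y f + X f * eta Y + Y f * eta X) =
    beta * (X beta * Y f + beta * X (Y f)) - X beta * (beta * Y f) - beta * (beta *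
      nabla X Y f)
    + beta * (beta * X f) * eta Y + beta * (beta * Y f) * eta X by ring.
  by rewrite H2 e1 e2 e3; ring.
have b3 := hor_cancel rm xi1 d0 H.
apply: smooth_funE => p; have := congr1 (fun h : 'C^oo(M) => h p) b3.
by rewrite !smoothM smooth0 => /eqP; rewrite !mulf_eq0 !orbb => /eqP.
Qed.

End Rigidity.

(** * Almost contact identities and the conclusion *)

Section AlmostContact.
Context {R : realType} {m : nat} {M : manifold R m.+1}.
Variable A : almost_contact_metric M.
Implicit Types X Y : 'Vect(M).
Local Notation g := (acm_g A).
Local Notation phi := (acm_phi A).
Local Notation xi := (acm_xi A).
Let rm : riemannian_metric g := acm_metric A.

Lemma g_xi_xi : g xi xi = 1.
Proof. by rewrite -acm_etaE acm_eta_xi. Qed.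

Lemma phi_xi : phi xi = 0.
Proof.
apply: (null_eq0 rm) => p.
by rewrite acm_phi_g acm_eta_xi g_xi_xi mulr1 subrr.
Qed.

Lemma phiZ h X : phi (h *: X) = h *: phi X.
Proof. exact: linearZ_LR. Qed.

Lemma phiN X : phi (- X) = - phi X.
Proof. exact: raddfN. Qed.
Lemma phiD X Y : phi (X + Y) = phi X + phi Y.
Proof. exact: raddfD. Qed.

(** Compare the two evaluations of the third power of phi on X. *)
Lemma eta_phi X : g (phi X) xi = 0.
Proof.
have := acm_phi2 A (phi X).
rewrite (acm_phi2 A X) phiD phiN phiZ phi_xi scaler0 addr0.
move=> /(congr1 (fun Y => g Y xi)).
rewrite (metricDl rm) !(metricNl rm) (metricZl rm) g_xi_xi mulr1 acm_etaE => H.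
apply: (eq_of_sub (esym H)); ring.
Qed.

(** On horizontal fields phi is an isometry with square -1, so g(X, phi X) equals its own
    opposite. *)
Lemma phi_rotation X : g X xi = 0 ->
  exists Y, [/\ g Y xi = 0, g X Y = 0 & g Y Y = g X X].
Proof.
move=> X0; exists (phi X); split; first exact: eta_phi.
  have := acm_phi_g A X (phi X); rewrite (acm_phi2 A X) !acm_etaE X0 scale0r addr0.
  rewrite (metricNr rm) (metricC rm (phi X)) => H.
  apply: smooth_double_inj; apply: (eq_of_sub (esym H)); ring.
by rewrite acm_phi_g !acm_etaE X0 mul0r subr0.
Qed.

(** The Kenmotsu condition on [xi] gives phi (nabla X xi) = phi X. Applying phi again determines
    nabla X xi, which is horizontal because [xi] has unit length. *)
Lemma kenmotsu_nabla_xi nabla X : levi_civita g nabla -> kenmotsu A nabla ->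
  nabla X xi = X - g X xi *: xi.
Proof.
move=> lc kA; have := kA X xi.
rewrite phi_xi acm_eta_xi scale1r eta_phi scale0r sub0r.
have -> : nabla X 0 = 0 by have := nablaBr lc 0 0 X; rewrite !subrr.
rewrite sub0r => /oppr_inj /(congr1 phi); rewrite !acm_phi2 !acm_etaE.
have -> : g (nabla X xi) xi = 0.
  have := lc_metric lc xi xi X; rewrite g_xi_xi derivation1 (metricC rm xi) => H.
  by apply: smooth_double_inj; apply: (eq_of_sub (esym H)); ring.
rewrite scale0r addr0 => H; rewrite -[LHS]opprK H opprD opprK; by [].
Qed.

End AlmostContact.

Lemma eta_einstein_soliton (R : realType) (d : nat) (d0 : (0 < d)%N)
    (M : manifold R d.+1) (A : almost_contact_metric M)
    (nabla : 'Vect(M) -> 'Vect(M) -> 'Vect(M)) (S : 'Vect(M) -> 'Vect(M) -> 'C^oo(M))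
    (p : R) (V : 'Vect(M)) (lambda mu : R) :
  levi_civita (acm_g A) nabla -> ricci_tensor (acm_g A) nabla S ->
  kenmotsu A nabla -> eta_einstein A S ->
  conformal_eta_ricci_soliton A S p V lambda mu -> einstein A S.
Proof.
move=> nabla_lc S_ricci kA [alpha [beta SE0]] soliton.
set g := acm_g A in nabla_lc S_ricci SE0 *; set xi := acm_xi A in SE0 *.
have rm : riemannian_metric g := acm_metric A.
have xi1 : g xi xi = 1 := g_xi_xi A.
have nxi X : nabla X xi = X - g X xi *: xi by exact: (kenmotsu_nabla_xi X nabla_lc kA).
have SE X Y : S X Y = alpha * g X Y + beta * (g X xi * g Y xi).
  by rewrite SE0 !acm_etaE.
have aE := alphaE rm nabla_lc xi1 nxi S_ricci SE.
pose c1 := 2 * lambda - (p + 2 / d.+1%:R).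
(* Substituting alpha = -d - beta and g = hor + eta eta: the two beta contributions to the eta eta
   coefficient cancel, so that coefficient is constant. *)
have lieV X Y : lie_derivative V g X Y =
    (2 * beta + cstf (2 * d%:R - c1)) * hor g xi X Y
    + 2 * cstf (d%:R - c1 / 2 - mu) * (g X xi * g Y xi).
  have := soliton X Y; rewrite -/c1 SE aE !acm_etaE => H.
  apply: smooth_funE => q; have := congr1 (fun h : 'C^oo(M) => h q) H.
  rewrite /hor !(smoothD, smoothM, smoothN, smoothZ, cstfE) smooth0 !smooth1.
  rewrite -/g; lra.
have dcst (a : R) (X : 'Vect(M)) : X (cstf a) = 0 by exact: vfield_cst.
have k_eq0 := soliton_const_eq0 rm nabla_lc xi1 nxi S_ricci d0 SE (dcst _) (dcst _)
  lieV.
have gD := g_soliton_grad rm nabla_lc xi1 nxi lieV.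
have hf := hess_potential rm nabla_lc xi1 nxi S_ricci d0 SE (dcst _) (dcst _) lieV.
have xf := xi_f rm nabla_lc xi1 nxi lieV.
have lieV0 X Y : lie_derivative V g X Y = (2 * beta + cstf (2 * d%:R - c1)) * hor g
  xi X Y.
  by rewrite lieV k_eq0; ring.
have hf0 X Y : hess nabla (g V xi) X Y = 2 * beta * hor g xi X Y
    - X (g V xi) * g Y xi - Y (g V xi) * g X xi.
  by rewrite hf k_eq0; ring.
rewrite k_eq0 in xf.
have [W [W0 lieW]] := exists_leaf_field rm nabla_lc xi1 nxi lieV0 erefl gD xf hf0.
have dsig (X : 'Vect(M)) : X (cstf 2^-1 * cstf (2 * d%:R - c1) - g V xi) = - X (g V xi).
  by rewrite derivationB derivationM !vfield_cst mul0r mulr0 addr0 sub0r.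
have b0 := beta_eq0 rm nabla_lc xi1 nxi S_ricci d0 SE gD xf hf0 W0 dsig lieW
  (@phi_rotation _ _ _ A).
by exists alpha => X Y; rewrite SE b0 mul0r addr0.
Qed.

Theorem theorem3p5 (R : realType) (n : nat) (n_ge1 : (1 <= n)%N)
    (M : manifold R (2 * n).+1) (A : almost_contact_metric M)
    (nabla : 'Vect(M) -> 'Vect(M) -> 'Vect(M)) (S : 'Vect(M) -> 'Vect(M) -> 'C^oo(M))
    (nabla_lc : levi_civita (acm_g A) nabla)
    (S_ricci : ricci_tensor (acm_g A) nabla S)
    (A_kenmotsu : kenmotsu A nabla)
    (A_eta_einstein : eta_einstein A S) (p : R) :
  (exists (V : 'Vect(M)) (lambda mu : R),
     conformal_eta_ricci_soliton A S p V lambda mu) ->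
  einstein A S.
Proof.
move=> [V [lambda [mu soliton]]].
apply: eta_einstein_soliton nabla_lc S_ricci A_kenmotsu A_eta_einstein soliton.
by rewrite muln_gt0 n_ge1.
Qed.
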